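(* Let $F$ be a field and let $A$ be a (finite-dimensional) central division $F$-algebra containing a Galois extension $K/F$ with abelian Galois group $G=\mathrm{Gal}[K/F]$, such that $\mathrm{char}\,F$ does not divide $\deg A$. Let $\Gamma$ be a totally ordered abelian (additive) group and let $\varepsilon:\Gamma\to G$ be a surjective homomorphism. If $A$ contains no maximal subfield $M$ containing $K$ such that $M/F$ is a Galois extension, then the Mal'cev-Neumann ring $\mathcal{D}=C_A(K)((\Gamma))$ is a noncrossed product division algebra.
   Context: $C_A(K)$ is the centralizer of $K$ in $A$. Construction of the Mal'cev-Neumann ring $C_A(K)((\Gamma))$: by the Skolem-Noether theorem, for each $\sigma\in G$ choose $u_\sigma\in A^\times$ with $x^\sigma=u_\sigma^{-1}xu_\sigma$ for all $x\in K$, with $u_{\mathrm{Id}}=1$. The elements of $C_A(K)((\Gamma))$ are formal series $\sum_{\gamma\in\Gamma}a_\gamma r_\gamma$ in indeterminates $a_\gamma$, with $r_\gamma\in C_A(K)$, whose support $\{\gamma\in\Gamma\mid r_\gamma\ne 0\}$ is well-ordered. Addition is componentwise; multiplication is determined by the rules $r a_\gamma=a_\gamma\,(u_{\varepsilon(\gamma)}^{-1}ru_{\varepsilon(\gamma)})$ for $r\in C_A(K)$, $\gamma\in\Gamma$, and $a_\gamma a_\delta=a_{\gamma+\delta}\,u_{\varepsilon(\gamma)\varepsilon(\delta)}^{-1}u_{\varepsilon(\gamma)}u_{\varepsilon(\delta)}$ for $\gamma,\delta\in\Gamma$. This is a well-defined associative ring. A finite-dimensional central simple algebra over a field $E$ is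 a crossed product if it contains a maximal commutative subalgebra that is a Galois field extension of $E$. A noncrossed product division algebra is a division algebra, finite-dimensional over its center, that is not a crossed product over its center. The degree $\deg A$ is the square root of $[A:F]$. *)

(* Defs.v *)
From HB Require Import structures.
From mathcomp Require Import all_boot all_order all_algebra all_fingroup.
From mathcomp Require Import all_field.
From mathcomp Require Import mathcomp_extra boolp wochoice classical_sets functions.
From mathcomp Require Import cardinality fsbigop.

Set Implicit Arguments.
Unset Strict Implicit.
Unset Printing Implicit Defensive.

Import Order.TTheory GRing.Theory Num.Theory.

Local Open Scope classical_set_scope.
Local Open Scope ring_scope.

HB.mixin Record isTotallyOrderedZmodule (G : Type) of Num.POrderedZmodule G := {
  orderedZmod_total : total (<=%R : rel G);
  ler_translate : forall z x y : G, x <= y -> x + z <= y + z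
}.

#[short(type="orderedZmodType")]
HB.structure Definition OrderedZmodule :=
  { G of Num.POrderedZmodule G & isTotallyOrderedZmodule G }.

Section RingNotions.
Variable D : nzRingType.

Definition division_ring : Prop :=
  forall x : D, x != 0 -> exists y, x * y = 1 /\ y * x = 1.

Definition ring_center : set D := [set z | forall x, z * x = x * z].

Definition fin_dim_over_center : Prop :=
  exists (n : nat) (b : 'I_n -> D), forall x, exists c : 'I_n -> D,
    (forall i, ring_center (c i)) /\ x = \sum_(i < n) c i * b i.

Definition commutative_subalgebra (M : set D) : Prop :=
  [/\ ring_center `<=` M,
      forall x y, M x -> M y -> M (x - y),
      forall x y, M x -> M y -> M (x * y)
    & forall x y, M x -> M y -> x * y = y * x].

Definition maximal_commutative_subalgebra (M : set D) : Prop :=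
  commutative_subalgebra M /\
  forall N, commutative_subalgebra N -> M `<=` N -> N = M.

(* E stands for the center of D: f carries the scalars of L onto it, so that
   range f is an isomorphic copy in D of the Galois extension L / E. *)
Definition crossed_product_over_center : Prop :=
  exists (E : fieldType) (L : splittingFieldType E) (f : {rmorphism L -> D}),
    [/\ range (fun e : E => f e%:A) = ring_center,
        galois 1 {:L}
      & maximal_commutative_subalgebra (range f)].

Definition noncrossed_product_division_algebra : Prop :=
  [/\ division_ring, fin_dim_over_center & ~ crossed_product_over_center].

End RingNotions.

Section Subfields.
Variables (F : fieldType) (A : falgType F).

(* Subfields of A containing F, hence subspaces. *)
Definition is_subfield (M : {vspace A}) : Prop :=
  [/\ 1 \in M,
      {in M &, forall x y, x * y \in M},
      {in M &, commutative *%R}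
    & {in M, forall x, x != 0 -> exists2 y, y \in M & x * y = 1}].

Definition maximal_subfield (M : {vspace A}) : Prop :=
  is_subfield M /\ forall N, is_subfield N -> (M <= N)%VS -> N = M.

End Subfields.

Lemma mem_gal1 (F : fieldType) (K : splittingFieldType F) (s : gal_of {:K}) :
  s \in 'Gal({:K} / 1)%g.
Proof. by rewrite gal_kHom ?sub1v// k1HomE ahomWin. Qed.

(* A choice of elements u_s as given by the Skolem-Noether theorem.  By
   mem_gal1, gal_of {:K} is the Galois group of K / F; its elements act on the
   right: (s * t)%g x = t (s x). *)
Record skolem_noether_choice (F : fieldType) (A : falgType F)
    (K : splittingFieldType F) (iota : 'AHom(K, A)) := SkolemNoetherChoice {
  sn_elt :> gal_of {:K} -> A;
  sn_unit : forall s : gal_of {:K}, sn_elt s \is a GRing.unit;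
  sn_conj : forall (s : gal_of {:K}) (x : K),
    iota (s x) = (sn_elt s)^-1 * iota x * sn_elt s;
  sn_one : sn_elt 1%g = 1
}.

Section WellOrderedSupport.
Variable Gam : orderedZmodType.
Implicit Types (P Q : {pred Gam}) (x y z : Gam).

Definition well_ordered P := wo_chain (<=%R : rel Gam) P.

Fact orderedZmod_comparable x y : x >=< y.
Proof. exact: orderedZmod_total. Qed.
Let cmp := orderedZmod_comparable.

Lemma well_orderedP P : well_ordered P <->
  forall X : set Gam, X `<=` [set x | x \in P] -> X !=set0 ->
    exists2 m, X m & forall x, X x -> m <= x.
Proof.
split=> [woP X XP [x Xx]|woP].
  have [||m [[mX mle] _]] := woP (fun x => `[< X x >]).
  - by move=> z; rewrite !unfold_in => /asboolP/XP.
  - by exists x; apply/asboolP.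
  exists m; first by apply/asboolP; exact: mX.
  by move=> z Xz; apply: mle; apply/asboolP.
apply: antisymmetric_wo_chain => [x y _ _|X XP [x Xx]]; first exact: le_anti.
have [||m Xm mle] := woP [set z | z \in X].
- by move=> z /= /XP.
- by exists x.
by exists m.
Qed.

Lemma well_ordered_sub P Q : {subset Q <= P} -> well_ordered P -> well_ordered Q.
Proof.
move=> QP /well_orderedP woP; apply/well_orderedP => X XQ; apply: woP.
by move=> x /XQ /QP.
Qed.

Lemma well_orderedU P Q : well_ordered P -> well_ordered Q ->
  well_ordered [pred x | (x \in P) || (x \in Q)].
Proof.
move=> /well_orderedP woP /well_orderedP woQ; apply/well_orderedP => X XPQ [x Xx].
have hP := woP (X `&` [set x | x \in P]) (@subIsetr _ _ _).
have hQ := woQ (X `&` [set x | x \in Q]) (@subIsetr _ _ _).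
have [/hP[p [Xp _] ple]|/set0P/negP/negPn/eqP/seteqP[P0 _]] :=
    pselect (X `&` [set x | x \in P] !=set0);
  have [/hQ[q [Xq _] qle]|/set0P/negP/negPn/eqP/seteqP[Q0 _]] :=
    pselect (X `&` [set x | x \in Q] !=set0).
- exists (Order.min p q); first by case: (comparable_leP (cmp p q)).
  move=> z Xz; rewrite comparable_ge_min ?cmp//; have /orP[zP|zQ] := XPQ _ Xz.
    by rewrite ple.
  by rewrite qle ?orbT.
- exists p => // z Xz; have /orP[zP|zQ] := XPQ _ Xz; first exact: ple.
  by have := Q0 z (conj Xz zQ).
- exists q => // z Xz; have /orP[zP|zQ] := XPQ _ Xz; last exact: qle.
  by have := P0 z (conj Xz zP).
by have /orP[zP|zQ] := XPQ _ Xx; [have := P0 x (conj Xx zP)|have := Q0 x (conj Xx zQ)].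
Qed.

Lemma ltr_translate z x y : x < y -> x + z < y + z.
Proof.
rewrite !lt_neqAle => /andP[xy /(ler_translate z)->]; rewrite andbT.
by apply: contraNneq xy => /addIr ->.
Qed.

Lemma ltr_transl z x y : x < y -> z + x < z + y.
Proof. by rewrite ![z + _]addrC; apply: ltr_translate. Qed.

Lemma ler_transl z x y : x <= y -> z + x <= z + y.
Proof. by rewrite ![z + _]addrC; apply: ler_translate. Qed.

Definition sumpred P Q : {pred Gam} :=
  fun z => `[< exists x y, [/\ x \in P, y \in Q & z = x + y] >].

Lemma well_orderedD P Q :
  well_ordered P -> well_ordered Q -> well_ordered (sumpred P Q).
Proof.
move=> /well_orderedP woP /well_orderedP woQ; apply/well_orderedP => X XPQ X0.
(* the least first summand below a given bound *)
have minP (Y : set Gam) : Y `<=` X -> Y !=set0 -> exists x y,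
    [/\ x \in P, y \in Q, Y (x + y) &
     forall x' y', x' \in P -> y' \in Q -> Y (x' + y') -> x <= x'].
  move=> YX [z Yz]; pose B := [set x | x \in P /\ exists2 y, y \in Q & Y (x + y)].
  have [x By||x [xP [y yQ Yxy]] xle] := woP B.
  - by case: By.
  - have /asboolP[x [y [xP yQ zE]]] := XPQ _ (YX _ Yz).
    by exists x; split=> //; exists y; rewrite // -zE.
  exists x, y; split=> // x' y' x'P y'Q Y'; apply: xle; split=> //.
  by exists y'.
pose B := [set y | y \in Q /\ exists x, [/\ x \in P, X (x + y) &
  forall x' y', x' \in P -> y' \in Q -> X (x' + y') -> x' + y' <= x + y -> x <= x']].
have [y By||y [yQ [x [xP Xxy xle]]] yle] := woQ B.
- by case: By.
- have [x [y [xP yQ Xxy xle]]] := minP X (fun _ => id) X0.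
  by exists y; split=> //; exists x; split=> // x' y' x'P y'Q Xx' _; apply: xle x'P y'Q Xx'.
exists (x + y) => // z Xz; rewrite comparable_leNgt ?cmp//; apply/negP => zlt.
have [||x1 [y1 [x1P y1Q [Xxy1 lt1] x1le]]] := minP (X `&` [set z | z < x + y]).
- by move=> ? [].
- by exists z.
have /yle : B y1.
  split=> //; exists x1; split=> // x' y' x'P y'Q X' le'.
  by apply: (x1le x' y') => //; split=> //=; apply: le_lt_trans le' lt1.
have xx1 : x <= x1 by apply: xle x1P y1Q Xxy1 (ltW lt1).
move=> yy1; move: lt1; rewrite /= comparable_ltNge ?cmp// => /negP; apply.
by apply: le_trans (ler_transl _ yy1); apply: ler_translate.
Qed.

(* The set is well-ordered both by <= and by >=. *)
Lemma well_ordered_finite P Q z : well_ordered P -> well_ordered Q ->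
  finite_set [set x | x \in P /\ z - x \in Q].
Proof.
move=> /well_orderedP woP /well_orderedP woQ.
set S := [set x | _]; pose T x := [set y | S y /\ y < x].
have maxS (Y : set Gam) : Y `<=` S -> Y !=set0 ->
    exists2 m, Y m & forall y, Y y -> y <= m.
  move=> YS [y Yy]; have [||w] := woQ [set w | Y (z - w)].
  - by move=> w /= /YS[_]; rewrite opprB addrC subrK.
  - by exists (z - y); rewrite /= opprB addrC subrK.
  move=> Yw wle; exists (z - w) => // t Yt.
  have zt : z - (z - t) = t by rewrite opprB addrC subrK.
  have /wle/(ler_translate (t - w)) : [set w | Y (z - w)] (z - t) by rewrite /= zt.
  by rewrite [w + _]addrC subrK addrA subrK.
have down x : S x -> infinite_set (T x) -> False.
  move=> Sx Tx.
  have [||m [Sm Tm] mle] := woP [set x | S x /\ infinite_set (T x)].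
  - by move=> ? [[]].
  - by exists x.
  have [||w [Sw wm] wle] := maxS (T m).
  - by move=> ? [].
  - by apply/set0P; apply: contra_notN Tm => /eqP ->.
  have : infinite_set (T w).
    apply: contra_not Tm => Tw; apply: (@sub_finite_set _ _ (T w `|` [set w])).
      move=> y [Sy ym]; have := wle y (conj Sy ym).
      by rewrite le_eqVlt => /orP[/eqP->|yw]; [right|left].
    by rewrite finite_setU; split=> //; exact: finite_set1.
  by move=> Tw; have := mle w (conj Sw Tw); rewrite comparable_leNgt ?cmp// wm.
have [S0|/set0P/negP/negPn/eqP->] := pselect (S !=set0); last exact: finite_set0.
have [//|m Sm mle] := maxS S _ S0.
apply: (@sub_finite_set _ _ (T m `|` [set m])).
  by move=> y Sy; have := mle y Sy; rewrite le_eqVlt => /orP[/eqP->|]; [right|left].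
rewrite finite_setU; split; last exact: finite_set1.
by apply: contrapT => /(down _ Sm).
Qed.

End WellOrderedSupport.

Section Convolution.
Variables (R : nzRingType) (Gam : orderedZmodType).
Implicit Types (f g h : Gam -> R) (x y z : Gam).

Definition supp f : {pred Gam} := [pred x | f x != 0].

Definition conv f g z := \sum_(x \in [set: Gam]) f x * g (z - x).

Lemma conv_finite f g z : well_ordered (supp f) -> well_ordered (supp g) ->
  finite_set [set x | f x != 0 /\ g (z - x) != 0].
Proof. exact: well_ordered_finite. Qed.

Lemma convE (S : set Gam) f g z :
  [set x | f x != 0 /\ g (z - x) != 0] `<=` S ->
  conv f g z = \sum_(x \in S) f x * g (z - x).
Proof.
move=> sub; apply/esym/fsbig_widen => // x [_ /= Sx].
have [->|f0] := eqVneq (f x) 0; first by rewrite mul0r.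
have [->|g0] := eqVneq (g (z - x)) 0; first by rewrite mulr0.
by case: Sx; apply: sub.
Qed.

Lemma supp_conv f g : {subset supp (conv f g) <= sumpred (supp f) (supp g)}.
Proof.
move=> z; rewrite inE /= => fgz; apply/asboolP; apply: contrapT => nz.
move: fgz => /eqP; apply; apply: fsbig1 => x _.
have [->|f0] := eqVneq (f x) 0; first by rewrite mul0r.
have [->|g0] := eqVneq (g (z - x)) 0; first by rewrite mulr0.
by case: nz; exists x, (z - x); split; rewrite // addrC subrK.
Qed.

Lemma well_ordered_conv f g : well_ordered (supp f) -> well_ordered (supp g) ->
  well_ordered (supp (conv f g)).
Proof.
by move=> wf wg; apply: well_ordered_sub (@supp_conv f g) (well_orderedD wf wg).
Qed.

Lemma fsumr_distrr (S : set Gam) (a : R) (F : Gam -> R) : finite_set S ->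
  a * (\sum_(x \in S) F x) = \sum_(x \in S) a * F x.
Proof. by move=> Sfin; rewrite !fsbig_finite//= big_distrr. Qed.

Lemma fsumr_distrl (S : set Gam) (a : R) (F : Gam -> R) : finite_set S ->
  (\sum_(x \in S) F x) * a = \sum_(x \in S) F x * a.
Proof. by move=> Sfin; rewrite !fsbig_finite//= big_distrl. Qed.

Lemma convA f g h : well_ordered (supp f) -> well_ordered (supp g) ->
  well_ordered (supp h) -> conv f (conv g h) =1 conv (conv f g) h.
Proof.
move=> wf wg wh z.
have wfg := well_orderedD wf wg; have wgh := well_orderedD wg wh.
pose A := [set x | x \in supp f /\ z - x \in sumpred (supp g) (supp h)].
pose B := [set y | y \in sumpred (supp f) (supp g) /\ z - y \in supp h].
have Afin : finite_set A by apply: well_ordered_finite.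
have Bfin : finite_set B by apply: well_ordered_finite.
rewrite (@convE A); last by move=> x [f0 /supp_conv gh0].
rewrite (@convE B); last by move=> x [/supp_conv fg0 h0].
pose T x y := f x * g (y - x) * h (z - y).
have T0 x y : T x y != 0 -> A x /\ B y.
  rewrite /T => T0.
  have f0 : f x != 0 by apply: contraNneq T0 => ->; rewrite !mul0r.
  have g0 : g (y - x) != 0 by apply: contraNneq T0 => ->; rewrite mulr0 mul0r.
  have h0 : h (z - y) != 0 by apply: contraNneq T0 => ->; rewrite mulr0.
  split; split=> //; apply/asboolP.
    by exists (y - x), (z - y); split=> //; rewrite [RHS]addrC addrA subrK.
  by exists x, (y - x); split=> //; rewrite addrC subrK.
transitivity (\sum_(x \in A) \sum_(y \in B) T x y).
  apply: eq_fsbigr => x /set_mem Ax.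
  rewrite /conv (reindex_fsbigT (fun y => y - x)) /=; last first.
    by exists (fun y => y + x) => y; rewrite ?subrK ?addrK.
  pose S := B `|` [set y | g (y - x) != 0 /\ h (z - y) != 0].
  have Sfin : finite_set S.
    rewrite /S finite_setU; split=> //.
    have := finite_image (fun y => y + x) (conv_finite (z - x) wg wh).
    apply: sub_finite_set => y /= [g0 h0]; exists (y - x); last by rewrite subrK.
    by rewrite /= opprB addrA subrK.
  have -> : \sum_(y \in [set: Gam]) g (y - x) * h (z - x - (y - x)) =
            \sum_(y \in S) g (y - x) * h (z - y).
    have zy y : z - x - (y - x) = z - y by rewrite opprB addrA subrK.
    under eq_fsbigr do rewrite zy.
    apply/esym/fsbig_widen => // y [_ /= Sy].
    have [->|g0] := eqVneq (g (y - x)) 0; first by rewrite mul0r.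
    have [->|h0] := eqVneq (h (z - y)) 0; first by rewrite mulr0.
    by case: Sy; right.
  rewrite fsumr_distrr//; under eq_fsbigr do rewrite mulrA.
  apply/esym/fsbig_widen => [y By|y [_ By]]; first by left.
  by apply/eqP; apply: contra_notT By => /T0[].
rewrite exchange_fsbig//; apply: eq_fsbigr => y /set_mem By.
pose S := A `|` [set x | f x != 0 /\ g (y - x) != 0].
have Sfin : finite_set S by rewrite finite_setU; split=> //; exact: conv_finite.
rewrite (@convE S); last by move=> x; right.
rewrite fsumr_distrl//; apply: fsbig_widen => [x Ax|x [_ Ax]]; first by left.
by apply/eqP; apply: contra_notT Ax => /T0[].
Qed.

Lemma convDl f1 f2 g z : well_ordered (supp f1) -> well_ordered (supp f2) ->
  well_ordered (supp g) ->
  conv (fun x => f1 x + f2 x) g z = conv f1 g z + conv f2 g z.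
Proof.
move=> w1 w2 wg; pose S := [set x | f1 x != 0 /\ g (z - x) != 0] `|`
                           [set x | f2 x != 0 /\ g (z - x) != 0].
have Sfin : finite_set S by rewrite finite_setU; split; exact: conv_finite.
rewrite !(@convE S); first last.
- move=> x [+ g0]; have [->|f10 _] := eqVneq (f1 x) 0; last by left.
  by rewrite add0r; right.
- by move=> x; left.
- by move=> x; right.
by rewrite -fsbig_split//; apply: eq_fsbigr => x _; rewrite mulrDl.
Qed.

Lemma convDr f g1 g2 z : well_ordered (supp f) -> well_ordered (supp g1) ->
  well_ordered (supp g2) ->
  conv f (fun x => g1 x + g2 x) z = conv f g1 z + conv f g2 z.
Proof.
move=> wf w1 w2; pose S := [set x | f x != 0 /\ g1 (z - x) != 0] `|`
                           [set x | f x != 0 /\ g2 (z - x) != 0].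
have Sfin : finite_set S by rewrite finite_setU; split; exact: conv_finite.
rewrite !(@convE S); first last.
- move=> x [f0]; have [->|g10 _] := eqVneq (g1 (z - x)) 0; last by left.
  by rewrite add0r; right.
- by move=> x; left.
- by move=> x; right.
by rewrite -fsbig_split//; apply: eq_fsbigr => x _; rewrite mulrDr.
Qed.

Lemma conv1l (a : R) g : conv (fun x => if x == 0 then a else 0) g =1 (fun z => a * g z).
Proof.
move=> z; rewrite (@convE [set 0]); last by move=> x /= [+ _]; case: (x =P 0) => //= _; rewrite eqxx.
by rewrite fsbig_set1 eqxx subr0.
Qed.

Lemma conv1r f (a : R) : conv f (fun x => if x == 0 then a else 0) =1 (fun z => f z * a).
Proof.
move=> z; rewrite (@convE [set z]); last first.
  by move=> x /= [_]; case: (z - x =P 0) => [/eqP|_]; rewrite ?eqxx// subr_eq0 => /eqP ->.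
by rewrite fsbig_set1 subrr eqxx.
Qed.

End Convolution.

Section Series.
Variables (F : fieldType) (A : falgType F) (K : splittingFieldType F).
Variables (iota : 'AHom(K, A)) (Gam : orderedZmodType).

(* r stands for the formal series \sum_g a_g (r g) with the indeterminates on
   the left of their coefficients; the latter lie in the centralizer of K. *)
Definition mn_series_pred : {pred Gam -> A} := fun r =>
  `[< (forall g, r g \in 'C(iota @: fullv)%VS) /\
      well_ordered [pred g | r g != 0] >].

Fact mn_series_zmod_closed : zmod_closed mn_series_pred.
Proof.
split=> [|r s].
  apply/asboolP; split=> [g|]; first exact: mem0v.
  apply/well_orderedP => X X0 [x /X0]; rewrite /= !inE; by rewrite eqxx.
move=> /asboolP[rC rwo] /asboolP[sC swo]; apply/asboolP; split=> [g|].
  by rewrite rpredB.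
apply: (well_ordered_sub _ (well_orderedU rwo swo)) => g; rewrite !inE /=.
apply: contraR; rewrite negb_or !negbK => /andP[/eqP rg0 /eqP sg0].
by rewrite -[(r - s) g]/(r g - s g) rg0 sg0 subrr.
Qed.
HB.instance Definition _ :=
  GRing.isZmodClosed.Build (Gam -> A) mn_series_pred mn_series_zmod_closed.

Record mn_series := MNSeries {
  mn_coef :> Gam -> A;
  _ : mn_coef \in mn_series_pred
}.
HB.instance Definition _ := [isSub for mn_coef].
HB.instance Definition _ := [Choice of mn_series by <:].
HB.instance Definition _ := [SubChoice_isSubZmodule of mn_series by <:].

Lemma mn_coefC (r : mn_series) g : r g \in 'C(iota @: fullv)%VS.
Proof. by have /asboolP[] := valP r. Qed.

Lemma mn_coef_wo (r : mn_series) : well_ordered (supp r).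
Proof. by have /asboolP[] := valP r. Qed.

Arguments mn_coef_wo r : clear implicits.

Lemma mn_seriesP (r s : mn_series) : r =1 s -> r = s.
Proof. by move=> rs; apply/val_inj/funext. Qed.

End Series.

Arguments mn_coef_wo {F A K iota Gam} r.

Section MalcevNeumann.
Variables (F : fieldType) (A : falgType F) (K : splittingFieldType F).
Variables (iota : 'AHom(K, A)) (Gam : orderedZmodType).
Variables (eps : Gam -> gal_of {:K}).
Hypothesis epsD : {morph eps : g h / g + h >-> (g * h)%g}.
Variable u : skolem_noether_choice iota.

Definition malcev_neumann & {morph eps : g h / g + h >-> (g * h)%g}
  & skolem_noether_choice iota : Type := mn_series iota Gam.
Local Notation MN := (malcev_neumann epsD u).
HB.instance Definition _ := GRing.Zmodule.on MN.

(* r a_g = a_g (mn_twist g r) *)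
Definition mn_twist (g : Gam) (r : A) : A := (u (eps g))^-1 * r * u (eps g).

(* a_g a_h = a_(g+h) (mn_cocycle g h) *)
Definition mn_cocycle (g h : Gam) : A :=
  (u (eps g * eps h)%g)^-1 * u (eps g) * u (eps h).

(* The coefficient at k of the product of r and s, where
   a_g (r g) a_h (s h) = a_(g+h) (mn_cocycle g h * mn_twist h (r g) * s h);
   for r and s in mn_series, almost all terms of this sum vanish. *)
Definition mn_mul_coef (r s : Gam -> A) (k : Gam) : A :=
  \sum_(g \in [set: Gam])
    mn_cocycle g (k - g) * mn_twist (k - g) (r g) * s (k - g).

Definition mn_monomial_coef (g : Gam) (a : A) : Gam -> A :=
  fun h => if h == g then a else 0.

Let U g := u (eps g).
Let untwist (r : Gam -> A) g := U g * r g.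

Let Uunit g : U g \is a GRing.unit. Proof. exact: sn_unit. Qed.

Let supp_untwist r : supp (untwist r) =i supp r.
Proof. by move=> g; rewrite !inE /= /untwist mulrI_eq0//; exact: mulrI. Qed.

Let untwist_wo (r : mn_series iota Gam) : well_ordered (supp (untwist r)).
Proof. by have := mn_coef_wo r; apply: well_ordered_sub => g; rewrite supp_untwist. Qed.

Lemma mn_mul_coefE (r s : mn_series iota Gam) k :
  mn_mul_coef r s k = (U k)^-1 * conv (untwist r) (untwist s) k.
Proof.
pose S := [set g | untwist r g != 0 /\ untwist s (k - g) != 0].
have Sfin : finite_set S by exact: conv_finite.
rewrite (@convE _ _ S)// fsumr_distrr//.
have step g : mn_cocycle g (k - g) * mn_twist (k - g) (r g) * s (k - g) =
    (U k)^-1 * (untwist r g * untwist s (k - g)).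
  rewrite /mn_cocycle /mn_twist /untwist -epsD addrC subrK -/(U k) -/(U g).
  by rewrite -/(U (k - g)) !mulrA mulrK// !mulrA.
rewrite /mn_mul_coef; under eq_fsbigr do rewrite step.
apply/esym/fsbig_widen => // g [_ /= Sg].
have [->|r0] := eqVneq (untwist r g) 0; first by rewrite mul0r mulr0.
have [->|s0] := eqVneq (untwist s (k - g)) 0; first by rewrite !mulr0.
by case: Sg.
Qed.

Lemma mem_centK (a : A) :
  reflect (forall x, a * iota x = iota x * a) (a \in 'C(iota @: fullv)%VS).
Proof.
apply: (iffP centvP) => [aC x|aC _ /memv_imgP[x _ ->]]; last exact: aC.
by apply: aC; rewrite memv_img ?memvf.
Qed.

Lemma mn_twistC g a :
  a \in 'C(iota @: fullv)%VS -> mn_twist g a \in 'C(iota @: fullv)%VS.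
Proof.
move=> /mem_centK aC; apply/mem_centK => x.
pose y := (eps g)^-1%g x.
have -> : iota x = (U g)^-1 * iota y * U g.
  by rewrite -sn_conj /y -galM ?memvf// mulVg gal_id.
by rewrite /mn_twist -/(U g) !mulrA !mulrK// -!mulrA; congr (_ * _); rewrite !mulrA aC.
Qed.

Lemma mn_cocycleC g h : mn_cocycle g h \in 'C(iota @: fullv)%VS.
Proof.
apply/mem_centK => x; pose y := (eps g * eps h)^-1%g x.
have xE : x = (eps g * eps h)%g y by rewrite /y -galM ?memvf// mulVg gal_id.
have e1 : iota x = (u (eps g * eps h)%g)^-1 * iota y * u (eps g * eps h)%g.
  by rewrite -sn_conj -xE.
have e2 : iota x = (U h)^-1 * ((U g)^-1 * iota y * U g) * U h.
  by rewrite -!sn_conj -galM ?memvf// -xE.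
rewrite {1}e2 e1 /mn_cocycle -/(U g) -/(U h) !mulrA mulrK// mulrK//.
by rewrite mulrK ?sn_unit.
Qed.

Fact mn_mul_subproof (r s : mn_series iota Gam) :
  mn_mul_coef r s \in @mn_series_pred _ _ _ iota Gam.
Proof.
apply/asboolP; split=> [k|].
  apply: memv_suml => g _.
  have mulC a b : a \in 'C(iota @: fullv)%VS -> b \in 'C(iota @: fullv)%VS ->
    a * b \in 'C(iota @: fullv)%VS.
    by move=> /mem_centK aC /mem_centK bC; apply/mem_centK => x; rewrite -mulrA bC !mulrA aC.
  apply: (mulC _ _ (mulC _ _ _ _)); first exact: mn_cocycleC.
    by apply: mn_twistC; exact: mn_coefC.
  exact: mn_coefC.
have := well_ordered_conv (@untwist_wo r) (@untwist_wo s).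
apply: well_ordered_sub => k; rewrite !inE /= mn_mul_coefE.
by apply: contraNneq => ->; rewrite mulr0.
Qed.

Definition mn_mul (r s : MN) : MN := MNSeries (mn_mul_subproof r s).

Let untwist_mul (r s : MN) :
  untwist (mn_mul r s) =1 conv (untwist r) (untwist s).
Proof. by move=> k; rewrite /untwist /= mn_mul_coefE mulVKr. Qed.

Let untwist_inj (r s : MN) : untwist r =1 untwist s -> r = s.
Proof. by move=> rs; apply: mn_seriesP => g; apply: (mulrI (Uunit g)); exact: rs. Qed.

Let untwistD (r s : MN) : untwist (r + s) =1 (fun g => untwist r g + untwist s g).
Proof. by move=> g; rewrite /untwist -mulrDr. Qed.

Fact mn_monomial_subproof g a : a \in 'C(iota @: fullv)%VS ->
  mn_monomial_coef g a \in @mn_series_pred _ _ _ iota Gam.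
Proof.
move=> aC; apply/asboolP; split=> [h|].
  by rewrite /mn_monomial_coef; case: ifP => // _; exact: mem0v.
apply/well_orderedP => X Xg [x Xx]; exists x => // y Xy.
have gE z : X z -> z = g.
  by move=> /Xg; rewrite /= !inE /mn_monomial_coef; case: (z =P g); rewrite ?eqxx.
by rewrite (gE x)// (gE y).
Qed.

(* The one-term series a_g a. *)
Definition mn_monomial g a (aC : a \in 'C(iota @: fullv)%VS) : MN :=
  MNSeries (mn_monomial_subproof g aC).

Definition mn_one : MN := mn_monomial 0 (centv1 _).

Let eps0 : eps 0 = 1%g.
Proof. by apply: (mulgI (eps 0)); rewrite -epsD addr0 mulg1. Qed.

Let untwist1 : untwist mn_one =1 (fun g => if g == 0 then 1 else 0).
Proof.
move=> g; rewrite /untwist /= /mn_monomial_coef; case: eqP => [->|_].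
  by rewrite mulr1 /U eps0 sn_one.
by rewrite mulr0.
Qed.

Let conv_ext (f f' g g' : Gam -> A) : f =1 f' -> g =1 g' -> conv f g =1 conv f' g'.
Proof. by move=> /funext -> /funext ->. Qed.

Fact mn_mulA : associative mn_mul.
Proof.
move=> r s t; apply: untwist_inj => k; rewrite !untwist_mul.
rewrite (conv_ext (fun=> erefl) (untwist_mul s t)).
rewrite (conv_ext (untwist_mul r s) (fun=> erefl)).
by apply: convA; exact: untwist_wo.
Qed.

Fact mn_mul1r : left_id mn_one mn_mul.
Proof.
move=> r; apply: untwist_inj => k.
by rewrite untwist_mul (conv_ext untwist1 (fun=> erefl)) conv1l mul1r.
Qed.

Fact mn_mulr1 : right_id mn_one mn_mul.
Proof.
move=> r; apply: untwist_inj => k.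
by rewrite untwist_mul (conv_ext (fun=> erefl) untwist1) conv1r mulr1.
Qed.

Fact mn_mulDl : left_distributive mn_mul +%R.
Proof.
move=> r s t; apply: untwist_inj => k; rewrite untwist_mul untwistD !untwist_mul.
rewrite (conv_ext (untwistD r s) (fun=> erefl)).
by apply: convDl; exact: untwist_wo.
Qed.

Fact mn_mulDr : right_distributive mn_mul +%R.
Proof.
move=> r s t; apply: untwist_inj => k; rewrite untwist_mul untwistD !untwist_mul.
rewrite (conv_ext (fun=> erefl) (untwistD s t)).
by apply: convDr; exact: untwist_wo.
Qed.

Fact mn_one_neq0 : mn_one != 0.
Proof.
apply/eqP => /(congr1 (fun r : MN => r 0)) /=; rewrite /mn_monomial_coef eqxx.
by move/eqP; rewrite oner_eq0.
Qed.

HB.instance Definition _ := GRing.Zmodule_isNzRing.Build MN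
  mn_mulA mn_mul1r mn_mulr1 mn_mulDl mn_mulDr mn_one_neq0.

Lemma mn_mulE (r s : MN) k : (r * s) k = mn_mul_coef r s k.
Proof. by []. Qed.

Lemma mn_monomialM g h a b (aC : a \in 'C(iota @: fullv)%VS)
    (bC : b \in 'C(iota @: fullv)%VS) k :
  (mn_monomial g aC * mn_monomial h bC) k =
    mn_monomial_coef (g + h) (mn_cocycle g h * mn_twist h a * b) k.
Proof.
rewrite mn_mulE /mn_mul_coef /= -(@fsbig_widen _ _ _ _ [set g])//; last first.
  move=> x [_ /= /eqP/negbTE xg]; rewrite /mn_monomial_coef xg /mn_twist.
  by rewrite !(mulr0, mul0r).
rewrite fsbig_set1 /mn_monomial_coef eqxx subr_eq [h + g]addrC.
by case: eqP => [->|_]; rewrite ?mulr0// [g + h]addrC addrK.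
Qed.

End MalcevNeumann.

(* Main.v *)
Require Import Defs.
From HB Require Import structures.
From mathcomp Require Import all_boot all_order all_algebra all_fingroup.
From mathcomp Require Import all_field.
From mathcomp Require Import boolp classical_sets fsbigop.

Set Implicit Arguments.
Unset Strict Implicit.
Unset Printing Implicit Defensive.

Import Order.TTheory GRing.Theory Num.Theory.

Local Open Scope ring_scope.

(** The coefficient of a series at g, once the indeterminate a_g is read as
    t^g u_(eps g), is an element of A_(eps g), where
      A_s = { a | x a = a (s x) for all x in K } = u_s C_A(K).
    The A_s make A a ring graded by G = Gal(K/F), and D becomes the ring of all
    series over Gamma with coefficient in A_(eps g) at g, multiplied by plain
    convolution.  Write n for deg A.  Three principles carry the proof.

    Successive approximation ([series_span]).  Gamma is totally ordered and
    supports are well ordered, so series can be glued coefficient by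
    coefficient.  If finitely many series have independent leading coefficients
    that generate those of some additive group Y, then they generate Y.
    This gives inverses in D, a basis of n^2 elements of D over its centre
    Z = F((ker eps)), and the fact that no subfield has a defect.

    Galois decomposition ([twisted_sum], [twisted_exists]).  If a division ring
    B contains a Galois extension L of its centre, then B is the direct sum of
    the nonzero spaces B_t = { y | l y = y (t l) }, each a coset d_t C_B(L) of
    the centralizer of L.  For K in A this yields the grading above and
    [K:F] dim C_A(K) = n^2.

    Passage to residues ([crossed_tame_residue]).  Suppose that D contains a
    maximal commutative subalgebra M that is Galois over Z with group T.  The
    decomposition of D along M gives [M:Z]^2 = n^2, so [M:Z] = n.  Let U be the
    residue field of M, a subfield of C_A(K), and let S be the image under eps
    of the value group of M.
    - M has no defect, so n <= |S| dim U.
    - A leading coefficient of M at g commutes with U and, by conjugation, acts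
      on K as eps g.  Hence 1, th, .., th^(|S|-1) are independent over U when
      K = F(th), and the field K U satisfies [K U : F] >= |S| dim U >= n.
    - The elements of D_t, for t in T, conjugate M into itself, so their leading
      coefficients conjugate U into itself and T acts on U.  As n is invertible
      in F, an element of U fixed by T is, up to the factor n, the residue of a
      trace from M to Z, so it lies in F.  By Artin's argument U/F is Galois, and so
      is K U / F.
    The centralizer of K U has dimension n^2 / [K U : F] <= n <= [K U : F], so
    K U is a maximal subfield of A.  It contains K and is Galois over F. *)

(** * Families over the image of a field *)

Section Families.
Variables (E : fieldType) (D : nzRingType) (z : {rmorphism E -> D}).

Definition fam_spans (Y : D -> Prop) (I : finType) (b : I -> D) :=
  forall y, Y y -> exists c : I -> E, y = \sum_i z (c i) * b i.

Definition fam_indep (I : finType) (b : I -> D) :=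
  forall c : I -> E, \sum_i z (c i) * b i = 0 -> forall i, c i = 0.

(** The coefficients of the b i on the w j form a matrix over E with more rows
    than columns if the inequality fails; a vector in its left kernel is a
    relation between the b i. *)
Lemma fam_indep_le_spans (Y : D -> Prop) (I J : finType) (b : I -> D) (w : J -> D) :
  (forall i, Y (b i)) -> fam_indep b -> fam_spans Y w -> (#|I| <= #|J|)%N.
Proof.
move=> Yb bI wS; rewrite leqNgt; apply/negP => JI.
have [a aE] := choice (fun i => wS _ (Yb i)).
pose m := \matrix_(i < #|I|, j < #|J|) a (enum_val i) (enum_val j).
have : kermx m != 0.
  rewrite kermx_eq0 /row_free neq_ltn; apply/orP; left.
  exact: leq_ltn_trans (rank_leq_col m) JI.
case/rowV0Pn => v /sub_kermxP vm0 /eqP; apply; apply/rowP => i; rewrite mxE.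
have := bI (fun i => v 0 (enum_rank i)); move=> /(_ _ (enum_val i)).
rewrite enum_valK; apply.
under eq_bigr do rewrite aE mulr_sumr.
rewrite exchange_big big1 //= => j _.
have /rowP/(_ (enum_rank j)) := vm0; rewrite !mxE => vmj.
transitivity (z (\sum_(i < #|I|) v 0 i * m i (enum_rank j)) * w j).
  rewrite rmorph_sum mulr_suml /= [RHS](reindex enum_rank) /=; last first.
    by exists enum_val => ? _; rewrite (enum_valK, enum_rankK).
  by apply: eq_bigr => k _; rewrite mxE !enum_rankK rmorphM mulrA.
by rewrite vmj rmorph0 mul0r.
Qed.

End Families.

Section TwoSided.
Variables (E : fieldType) (D : nzRingType) (z : {rmorphism E -> D}).
Hypotheses (divD : division_ring D)
  (centerD : forall x : D, (forall y, x * y = y * x) -> exists e, x = z e).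

(** In a shortest nontrivial relation, scaled so that some a j is 1, replacing x
    by y x and subtracting y times the relation gives a shorter one, with
    coefficients a i y - y a i.  Hence the a i are central, and x = 1
    contradicts the independence of b. *)
Lemma twosided_indep (I : finType) (b : I -> D) (a : I -> D) :
  fam_indep z b -> (forall x, \sum_i a i * x * b i = 0) -> forall i, a i = 0.
Proof.
move=> bI; move: {2}#|_|.+1 (ltnSn #|[set i | a i != 0]|) => k.
elim: k a => // k IHk a cardk sum0.
have [/existsP[j aj0]|/existsPn a0 i] := boolP [exists j, a j != 0]; last first.
  by apply/eqP; rewrite -[_ == _]negbK a0.
have [aj' [ajK ajK']] := divD aj0.
pose a' i := aj' * a i.
have sum0' x : \sum_i a' i * x * b i = 0.
  transitivity (aj' * \sum_i a i * x * b i); last by rewrite sum0 mulr0.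
  by rewrite mulr_sumr; apply: eq_bigr => i _; rewrite !mulrA.
have com y i : a' i * y = y * a' i.
  apply/eqP; rewrite -subr_eq0; apply/eqP.
  apply: (IHk (fun i => a' i * y - y * a' i)) => [|x].
    rewrite -ltnS; apply: leq_trans cardk; apply: proper_card; apply/properP.
    split; last by exists j; rewrite !inE ?aj0 // /a' ajK' mul1r mulr1 subrr eqxx.
    apply/fintype.subsetP=> l; rewrite !inE; apply: contra_neq => al0.
    by rewrite /a' al0 mulr0 mul0r mulr0 subrr.
  transitivity (\sum_i a' i * (y * x) * b i - y * \sum_i a' i * x * b i).
    rewrite mulr_sumr -sumrB; apply: eq_bigr => l _.
    by rewrite mulrBl mulrBl /= !mulrA.
  by rewrite !sum0' mulr0 subr0.
have [e eE] := choice (fun i => centerD (fun y => com y i)).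
have e0 : forall i, e i = 0.
  apply: bI; transitivity (\sum_i a' i * 1 * b i); last exact: sum0'.
  by apply: eq_bigr => i _; rewrite mulr1 eE.
have /eqP : a' j = 0 by rewrite eE e0 rmorph0.
by rewrite /a' ajK' oner_eq0.
Qed.

End TwoSided.

(** * Decomposition of a division ring along a Galois subfield *)

Lemma galois_generator (E : fieldType) (L : splittingFieldType E) :
  galois 1 {:L} ->
  exists th : L, forall l, exists2 q, q \is a polyOver 1%VS & l = q.[th].
Proof.
move=> /and3P[_ sepL _]; exists (separable_generator 1 {:L}) => l.
by apply/Fadjoin_polyP; rewrite -eq_adjoin_separable_generator ?sub1v ?memvf.
Qed.

Lemma gal_horner (E : fieldType) (L : splittingFieldType E) (t : gal_of {:L}) q (l : L) :
  q \is a polyOver 1%VS -> t q.[l] = q.[t l].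
Proof.
by move=> q1; rewrite -horner_map (fixedPoly_gal (sub1v _) (mem_gal1 t) q1).
Qed.

Lemma gal_generator_inj (E : fieldType) (L : splittingFieldType E) (th : L) :
    (forall l, exists2 q, q \is a polyOver 1%VS & l = q.[th]) ->
  injective (fun t : gal_of {:L} => t th).
Proof.
move=> gen s t st; apply/eqP/gal_eqP => l _.
by have [q q1 ->] := gen l; rewrite !gal_horner// st.
Qed.

Section GaloisDecomposition.
Variables (E : fieldType) (L : splittingFieldType E) (D : nzRingType).
Variable f : {rmorphism L -> D}.
Hypothesis galL : galois 1 {:L}.
Hypothesis centE : forall (e : E) (x : D), f e%:A * x = x * f e%:A.
Implicit Types (s t : gal_of {:L}) (l : L) (x y : D) (Q : {poly L}).

(** The component of t in the decomposition; for K in A it is the coset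
    u_t C_A(K). *)
Definition twisted t y := forall l, f l * y = y * f (t l).

Let theta : L := sval (cid (galois_generator galL)).

Let theta_gen l : exists2 q, q \is a polyOver 1%VS & l = q.[theta].
Proof. exact: (svalP (cid (galois_generator galL))). Qed.

Let c t : L := (t^-1)%g theta.

Let c_inj : injective c.
Proof. by move=> s t /(gal_generator_inj theta_gen)/invg_inj. Qed.

Let m : {poly L} := \prod_t ('X - (c t)%:P).

Let m1 : m \is a polyOver 1%VS.
Proof.
apply/polyOverP => i; have /galois_fixedField <- := galL.
apply/fixedFieldP => [|s _]; first exact: memvf.
suff sm : map_poly s m = m by rewrite -coef_map sm.
rewrite /m rmorph_prod (reindex_inj (mulgI s)) /=; apply: eq_bigr => t _.
rewrite rmorphB /= map_polyX map_polyC /=; congr ('X - _%:P).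
by rewrite /c invMg -galM ?memvf// -mulgA mulVg mulg1.
Qed.

(* Left multiplication by f c and right multiplication by f theta commute, so
   each Q over L can be evaluated, on its coefficients and at theta, as an
   operator on D. *)
Let act Q x := \sum_(i < size Q) f Q`_i * x * f theta ^+ i.

Let actE k Q x : (size Q <= k)%N -> act Q x = \sum_(i < k) f Q`_i * x * f theta ^+ i.
Proof.
move=> Qk; rewrite /act (big_ord_widen k (fun i => f Q`_i * x * f theta ^+ i))// big_mkcond /=.
apply: eq_bigr => i _; case: ltnP => // /leq_sizeP/(_ i (leqnn _)) ->.
by rewrite rmorph0 !mul0r.
Qed.

Let actDl Q Q' x : act (Q + Q') x = act Q x + act Q' x.
Proof.
pose k := maxn (size Q) (size Q').
rewrite !(@actE k) ?leq_maxl ?leq_maxr ?size_polyD// -big_split.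
by apply: eq_bigr => i _; rewrite coefD rmorphD !mulrDl.
Qed.

Let actZ a Q x : act (a *: Q) x = f a * act Q x.
Proof.
rewrite (@actE (size Q)) ?size_scale_leq// mulr_sumr.
by apply: eq_bigr => i _; rewrite coefZ rmorphM !mulrA.
Qed.

Let actX Q x : act ('X * Q) x = act Q x * f theta.
Proof.
have sQ : (size ('X * Q)%R <= (size Q).+1)%N.
  by rewrite (leq_trans (size_polyMleq _ _))// size_polyX.
rewrite (actE _ sQ) big_ord_recl coefXM eqxx rmorph0 !mul0r add0r mulr_suml.
by apply: eq_bigr => i _; rewrite coefXM lift0 /= exprSr mulrA.
Qed.

Let actDr Q x y : act Q (x + y) = act Q x + act Q y.
Proof. by rewrite -big_split; apply: eq_bigr => i _; rewrite mulrDr mulrDl. Qed.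

Let act0r Q : act Q 0 = 0.
Proof. by apply: big1 => i _; rewrite mulr0 mul0r. Qed.

Let act_sumr (I : finType) Q (y : I -> D) : act Q (\sum_i y i) = \sum_i act Q (y i).
Proof. exact: (big_morph _ (actDr Q) (act0r Q)). Qed.

Let act_suml (I : finType) (Q : I -> {poly L}) y : act (\sum_i Q i) y = \sum_i act (Q i) y.
Proof.
have actDl' : {morph act^~ y : Q Q' / Q + Q'} by move=> *; rewrite actDl.
apply: (big_morph (act^~ y) actDl'); by rewrite /act size_poly0 big_ord0.
Qed.

Let act_base Q x : Q \is a polyOver 1%VS -> act Q x = x * f Q.[theta].
Proof.
move=> /polyOverP Q1; rewrite horner_coef rmorph_sum mulr_sumr.
apply: eq_bigr => i _; rewrite rmorphM rmorphXn mulrA.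
by have /vlineP[e ->] := Q1 i; rewrite centE.
Qed.

Let act_m x : act m x = 0.
Proof.
rewrite act_base//; suff /rootP-> : root m theta by rewrite rmorph0 mulr0.
have -> : theta = c 1%g by rewrite /c invg1 gal_id.
by rewrite /m (bigD1 1%g)//= rootM root_XsubC eqxx.
Qed.

Let twist_gen t y : y * f theta = f (c t) * y -> twisted t y.
Proof.
move=> yth l; have pow i : y * f theta ^+ i = f (c t) ^+ i * y.
  elim: i => [|i IHi]; first by rewrite mulr1 mul1r.
  by rewrite exprSr mulrA IHi -mulrA yth mulrA -exprSr.
have [l' lE] : exists l', l = (t^-1)%g l'.
  by exists (t l); rewrite -galM ?memvf// mulgV gal_id.
have -> : t l = l' by rewrite lE -galM ?memvf// mulVg gal_id.
rewrite lE; have [q q1 ->] := theta_gen l'; rewrite gal_horner// -/(c t) !horner_coef.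
rewrite !rmorph_sum mulr_suml mulr_sumr; apply: eq_bigr => i _.
have /polyOverP/(_ i)/vlineP[e ->] := q1.
by rewrite !rmorphM !rmorphXn -mulrA -pow !mulrA centE.
Qed.

(* The Lagrange polynomials at the conjugates of theta: act (lagr t) is the
   projection of D onto the component of t, because ('X - c t) * lagr t is a
   multiple of m, which annihilates D. *)
Let lagr t : {poly L} :=
  \prod_(s | s != t) ((c t - c s)^-1 *: ('X - (c s)%:P)).

Let lagr_horner t s : (lagr t).[c s] = (s == t)%:R.
Proof.
rewrite /lagr horner_prod; case: eqVneq => [->|st].
  apply: big1 => r rt; rewrite hornerZ hornerXsubC mulVf// subr_eq0.
  by rewrite (inj_eq c_inj) eq_sym.
by rewrite (bigD1 s)//= hornerZ hornerXsubC subrr mulr0 mul0r.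
Qed.

Let size_lagr t : (size (lagr t) <= #|{: gal_of {:L}}|)%N.
Proof.
rewrite /lagr scaler_prod; apply: leq_trans (size_scale_leq _ _) _.
have -> : \prod_(s | s != t) ('X - (c s)%:P) =
    \prod_(s <- enum (predC1 t)) ('X - (c s)%:P) by rewrite big_enum.
rewrite size_prod_XsubC -cardE cardC1 prednK//.
by apply/card_gt0P; exists t.
Qed.

Let conj_eq0 Q : (size Q <= #|{: gal_of {:L}}|)%N -> (forall t, Q.[c t] = 0) -> Q = 0.
Proof.
move=> sQ Q0; apply/eqP; apply: contraTT sQ => Qn0; rewrite -ltnNge.
have -> : #|{: gal_of {:L}}| = size (map c (enum {: gal_of {:L}})).
  by rewrite size_map cardE.
apply: max_poly_roots Qn0 _ _; last by rewrite map_inj_uniq ?enum_uniq.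
by apply/allP => _ /mapP[t _ ->]; apply/rootP.
Qed.

Let sum_lagr : \sum_t lagr t = 1.
Proof.
apply/eqP; rewrite -subr_eq0; apply/eqP; apply: conj_eq0 => [|s].
  apply: leq_trans (size_polyD _ _) _; rewrite geq_max size_polyN size_poly1.
  rewrite (leq_trans (size_sum _ _ _)); last by apply/bigmax_leqP => t _.
  by apply/card_gt0P; exists 1%g.
rewrite hornerD hornerN hornerC horner_sum (bigD1 s)//= big1 => [|t ts].
  by rewrite lagr_horner eqxx addr0 subrr.
by rewrite lagr_horner eq_sym (negbTE ts).
Qed.

Let lagr_twisted t x : twisted t (act (lagr t) x).
Proof.
apply: twist_gen; apply/eqP; rewrite -subr_eq0; apply/eqP.
rewrite -actX -mulNr -rmorphN -actZ -actDl scaleNr.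
have -> : 'X * lagr t - c t *: lagr t = (\prod_(s | s != t) (c t - c s)^-1) *: m.
  rewrite -mul_polyC -mulrBl /lagr scaler_prod -scalerAr; congr (_ *: _).
  by rewrite /m [RHS](bigD1 t).
by rewrite actZ act_m mulr0.
Qed.

Lemma twisted_sum x : exists2 y : gal_of {:L} -> D,
  (forall t, twisted t (y t)) & x = \sum_t y t.
Proof.
exists (fun t => act (lagr t) x) => [t|]; first exact: lagr_twisted.
rewrite -act_suml sum_lagr act_base ?rpred1//.
by rewrite hornerC rmorph1 mulr1.
Qed.

Let act_twisted t y Q : twisted t y -> act Q y = f Q.[c t] * y.
Proof.
move=> yt; have pow i : y * f theta ^+ i = f (c t) ^+ i * y.
  rewrite -!rmorphXn yt; congr (_ * f _).
  by rewrite /= -galM ?memvf// mulVg gal_id.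
rewrite horner_coef rmorph_sum mulr_suml; apply: eq_bigr => i _.
by rewrite -mulrA pow rmorphM rmorphXn mulrA.
Qed.

Lemma twisted_direct (y : gal_of {:L} -> D) :
  (forall t, twisted t (y t)) -> \sum_t y t = 0 -> forall t, y t = 0.
Proof.
move=> yt y0 t; rewrite -[RHS](act0r (lagr t)) -y0 act_sumr (bigD1 t)//=.
rewrite (act_twisted _ (yt t)) lagr_horner eqxx rmorph1 mul1r big1 ?addr0// => s st.
by rewrite (act_twisted _ (yt s)) lagr_horner (negbTE st) rmorph0 mul0r.
Qed.

Hypotheses (divD : division_ring D)
  (centerD : forall x : D, (forall y, x * y = y * x) -> exists e : E, x = f e%:A).

(** Skolem-Noether for L.  The projection onto the component of t is a nontrivial
    combination of the operators x |-> f a * x * f theta ^+ i with i < [L : E],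
    and those are independent. *)
Lemma twisted_exists t : exists2 y, y != 0 & twisted t y.
Proof.
apply: contrapT => noy; have act0 x : act (lagr t) x = 0.
  apply/eqP; apply: contrapT => /negP a0; apply: noy.
  by exists (act (lagr t) x) => //; exact: lagr_twisted.
have coef0 (i : 'I_#|{: gal_of {:L}}|) : f (lagr t)`_i = 0.
  move: i; apply: (@twosided_indep E D (f \o in_alg L)%FUN divD centerD _
    (fun i : 'I__ => f theta ^+ i)) => [e e0 i|x].
    pose Q : {poly L} := \poly_(i < #|{: gal_of {:L}}|)
      if insub i is Some j then (e j)%:A else 0.
    have Qi (j : 'I__) : Q`_j = (e j)%:A by rewrite coef_poly ltn_ord valK.
    suff Q0 : Q = 0 by apply/eqP; rewrite -(fmorph_eq0 (in_alg L)) /= -Qi Q0 coef0.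
    apply: conj_eq0 => [|s]; first exact: size_poly.
    have Q1 : Q \is a polyOver 1%VS.
      apply/polyOverP => k; rewrite coef_poly; case: ifP => _; last exact: rpred0.
      by case: insub => [j|]; rewrite ?rpred0// rpredZ ?rpred1.
    rewrite -gal_horner// (_ : Q.[theta] = 0) ?rmorph0//.
    apply/eqP; rewrite -(fmorph_eq0 f); apply/eqP; rewrite -[RHS]e0.
    rewrite (horner_coef_wide _ (size_poly _ _)) rmorph_sum.
    by apply: eq_bigr => j _; rewrite Qi rmorphM rmorphXn.
  by rewrite -[RHS](act0 x) (actE _ (size_lagr t)).
have := lagr_horner t t; rewrite eqxx (horner_coef_wide _ (size_lagr t)) big1.
  by move/eqP; rewrite eq_sym oner_eq0.
move=> i _; rewrite (_ : (lagr t)`_i = 0) ?mul0r//.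
by apply/eqP; rewrite -(fmorph_eq0 f) coef0.
Qed.

Variable d : gal_of {:L} -> D.
Hypotheses (dt : forall t, twisted t (d t)) (d0 : forall t, d t != 0).

Definition cent y := forall l, f l * y = y * f l.

Lemma twisted_coset t y : twisted t y -> exists2 x, cent x & y = d t * x.
Proof.
move=> yt; have [d' [dd' d'd]] := divD (d0 t).
exists (d' * y) => [l|]; last by rewrite mulrA dd' mul1r.
pose k := (t^-1)%g l; have -> : l = t k by rewrite /k -galM ?memvf// mulVg gal_id.
have {1}-> : f (t k) = d' * (f k * d t) by rewrite dt mulrA d'd mul1r.
by rewrite -!mulrA [d t * _]mulrA dd' mul1r yt.
Qed.

(** A basis w of the centralizer of L and one nonzero d t in each component
    combine into a basis of D. *)
Lemma twisted_fam_indep (J : finType) (w : J -> D) :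
    (forall j, cent (w j)) -> fam_indep (f \o in_alg L)%FUN w ->
  fam_indep (f \o in_alg L)%FUN (fun p : gal_of {:L} * J => d p.1 * w p.2).
Proof.
move=> wC wI e e0 [t j]; pose x s := \sum_j f (e (s, j))%:A * w j.
have dx s : twisted s (d s * x s).
  move=> l; rewrite mulrA dt -!mulrA; congr (_ * _).
  rewrite mulr_suml mulr_sumr; apply: eq_bigr => i _.
  by rewrite -mulrA -wC !mulrA centE.
have dx0 : \sum_s d s * x s = 0.
  transitivity (\sum_s \sum_j f (e (s, j))%:A * (d s * w j)).
    apply: eq_bigr => s _; rewrite mulr_sumr; apply: eq_bigr => i _.
    by rewrite mulrA -centE -mulrA.
  by rewrite pair_big -[RHS]e0; apply: eq_bigr => -[].
have := twisted_direct dx dx0 t; have [d' [_ d'd]] := divD (d0 t).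
move/(congr1 (fun y => d' * y)); rewrite mulrA d'd mul1r mulr0.
by move=> xt0; exact: (wI (fun j => e (t, j)) xt0 j).
Qed.

Lemma twisted_fam_spans (J : finType) (w : J -> D) :
    fam_spans (f \o in_alg L)%FUN cent w ->
  fam_spans (f \o in_alg L)%FUN (fun=> True) (fun p : gal_of {:L} * J => d p.1 * w p.2).
Proof.
move=> wS x _; have [y yt ->] := twisted_sum x.
have /choice[e eE] : forall t, exists e : J -> E, y t = d t * \sum_j f (e j)%:A * w j.
  move=> t; have [x' x'C ->] := twisted_coset (yt t).
  by have [e ->] := wS _ x'C; exists e.
exists (fun p => e p.1 p.2).
rewrite -(pair_bigA _ (fun t j => f (e t j)%:A * (d t * w j))); apply: eq_bigr => t _.
by rewrite eE mulr_sumr; apply: eq_bigr => j _; rewrite mulrA -centE -mulrA.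
Qed.

End GaloisDecomposition.

(** * Rings of series and successive approximation *)

Section OrderedGroup.
Variable Gam : orderedZmodType.
Implicit Types x y z : Gam.

Lemma gam_ltNge x y : (x < y) = ~~ (y <= x).
Proof. exact/comparable_ltNge/orderedZmod_comparable. Qed.

Lemma gam_leNgt x y : (x <= y) = ~~ (y < x).
Proof. exact/comparable_leNgt/orderedZmod_comparable. Qed.

Lemma gam_lerD2r z x y : (x + z <= y + z) = (x <= y).
Proof.
apply/idP/idP => [/(ler_translate (- z))|/(ler_translate z)//].
by rewrite !addrK.
Qed.

Lemma gam_ltrD2r z x y : (x + z < y + z) = (x < y).
Proof. by rewrite !gam_ltNge gam_lerD2r. Qed.

Lemma gam_ltrBr x y z : (x < y - z) = (x + z < y).
Proof. by rewrite -(gam_ltrD2r z) subrK. Qed.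

Lemma gam_min (s : seq Gam) : s != [::] ->
  exists2 m, m \in s & forall x, x \in s -> m <= x.
Proof.
elim: s => // x [_ _|y s /(_ isT)[m ms mle] _].
  by exists x; rewrite ?mem_head// => y; rewrite inE => /eqP ->.
have [xm|] := boolP (x <= m).
  exists x; rewrite ?mem_head// => w; rewrite inE => /orP[/eqP->//|/mle].
  exact: le_trans.
rewrite -gam_ltNge => mx; exists m; first by rewrite inE ms orbT.
by move=> w; rewrite inE => /orP[/eqP->|/mle//]; exact: ltW.
Qed.

End OrderedGroup.

(** D is, through the coefficient map c, the ring of all series over Gam whose
    coefficient at g lies in H g. *)
Record hahn_ring (A : nzRingType) (Gam : orderedZmodType) (H : Gam -> A -> Prop)
    (D : nzRingType) (c : D -> Gam -> A) : Prop := HahnRing {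
  hahn_coefB : forall x y g, c (x - y) g = c x g - c y g;
  hahn_coefM : forall x y, c (x * y) =1 conv (c x) (c y);
  hahn_coef1 : forall g, c 1 g = if g == 0 then 1 else 0;
  hahn_inj : forall x y, c x =1 c y -> x = y;
  hahn_wo : forall x, well_ordered (supp (c x));
  hahn_mem : forall x g, H g (c x g);
  hahn_build : forall h : Gam -> A, (forall g, H g (h g)) ->
    well_ordered (supp h) -> exists x, c x =1 h
}.

Arguments hahn_wo {A Gam H D c} _ x.
Arguments hahn_mem {A Gam H D c} _ x g.

Section HahnRing.
Variables (A : nzRingType) (Gam : orderedZmodType) (H : Gam -> A -> Prop).
Variables (D : nzRingType) (c : D -> Gam -> A) (hD : hahn_ring H c).
Implicit Types (x y : D) (g h k : Gam) (a b : A).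

Lemma hahn_coef0 g : c 0 g = 0.
Proof. by rewrite -(subrr 0) (hahn_coefB hD) subrr. Qed.

Lemma hahn_coefN x g : c (- x) g = - c x g.
Proof. by rewrite -sub0r (hahn_coefB hD) hahn_coef0 sub0r. Qed.

Lemma hahn_coefD x y g : c (x + y) g = c x g + c y g.
Proof. by rewrite -{1}[y]opprK (hahn_coefB hD) hahn_coefN opprK. Qed.

Lemma hahn_coef_sum (I : Type) (r : seq I) (P : pred I) (x : I -> D) g :
  c (\sum_(i <- r | P i) x i) g = \sum_(i <- r | P i) c (x i) g.
Proof. by apply: (big_morph (c^~ g)) => [x1 x2|]; [exact: hahn_coefD|exact: hahn_coef0]. Qed.

Lemma hahn_mem0 g : H g 0.
Proof. by rewrite -(hahn_coef0 g); exact: (hahn_mem hD). Qed.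

Lemma hahn_monomial g a : H g a -> exists x, forall k, c x k = if k == g then a else 0.
Proof.
move=> Ha; apply: (hahn_build hD) => [k|].
  by case: eqP => [->|_] //; exact: hahn_mem0.
apply/well_orderedP => X Xg [k Xk]; exists k => // l Xl.
have E m : X m -> m = g.
  by move=> /Xg; rewrite /= !inE; case: (m =P g) => // _; rewrite eqxx.
by rewrite (E k)// (E l).
Qed.

Definition above x g := forall k, k < g -> c x k = 0.

Lemma lead_exists x : x != 0 -> exists2 g, above x g & c x g != 0.
Proof.
move=> x0; have /well_orderedP/(_ [set g | c x g != 0]%classic) := hahn_wo hD x.
case=> [//||g xg gle].
  apply: contrapT => nx; move/eqP: x0; apply; apply: (hahn_inj hD) => g.
  by rewrite hahn_coef0; apply/eqP; apply: contrapT => /negP xg; apply: nx; exists g.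
exists g => // k kg; apply/eqP; apply: contraTT kg => /gle.
by rewrite gam_ltNge negbK.
Qed.

Lemma coefM_eq0 x y k :
  (forall g, c x g = 0 \/ c y (k - g) = 0) -> c (x * y) k = 0.
Proof.
move=> xy0; rewrite (hahn_coefM hD); apply: fsbig1 => g _.
by case: (xy0 g) => ->; rewrite ?mul0r ?mulr0.
Qed.

Lemma aboveM x y g h : above x g -> above y h -> above (x * y) (g + h).
Proof.
move=> xg yh k kgh; apply: coefM_eq0 => m.
have [/xg ->|] := boolP (m < g); first by left.
rewrite -gam_leNgt => gm; right; apply: yh.
rewrite -(gam_ltrD2r m) subrK; apply: lt_le_trans kgh _.
by rewrite addrC; apply: ler_transl.
Qed.

Lemma coefM_lead x y g h : above x g -> above y h -> c (x * y) (g + h) = c x g * c y h.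
Proof.
move=> xg yh; rewrite (hahn_coefM hD) (@convE _ _ [set g]%classic).
  by rewrite fsbig_set1 [g + h]addrC addrK.
move=> m [xm ym]; apply/eqP; rewrite eq_le; apply/andP; split.
  rewrite gam_leNgt; apply: contra ym => gm; rewrite yh//.
  by rewrite -(gam_ltrD2r m) subrK addrC; apply: ltr_transl.
by rewrite gam_leNgt; apply: contra xm => mg; rewrite xg.
Qed.

(** The series e i multiply coefficients taken from B.  By lead_indep the leading
    terms of the e i * z i cannot cancel, so that z |-> \sum_i e i * z i
    preserves valuations. *)
Section Series.
Variables (B : Gam -> A -> Prop).
Hypotheses (BH : forall g a, B g a -> H g a) (B0 : forall g, B g 0)
  (BB : forall g a b, B g a -> B g b -> B g (a - b)).
Variables (I : finType) (e : I -> D) (g : I -> Gam).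
Hypothesis eg : forall i, above (e i) (g i).
Hypothesis lead_indep : forall k (b : I -> A), (forall i, B (k - g i) (b i)) ->
  \sum_i c (e i) (g i) * b i = 0 -> forall i, b i = 0.
Implicit Type z : I -> D.

Definition coefs_in z := forall i k, B k (c (z i) k).

(** If some coefficient that should vanish does not, consider the least h among
    the values of the e i * z i: the coefficient at h of the sum is a relation
    between leading coefficients. *)
Lemma series_unique z m : coefs_in z ->
  (forall k, k <= m -> c (\sum_i e i * z i) k = 0) ->
  forall i k, k + g i <= m -> c (z i) k = 0.
Proof.
move=> zB z0 i0 k0 km; apply/eqP/negPn/negP => zi0.
have /choice[v vE] : forall i, exists v, z i != 0 -> above (z i) v /\ c (z i) v != 0.
  move=> i; have [->|/lead_exists[v]] := eqVneq (z i) 0; last by exists v.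
  by exists 0.
have [|h] := @gam_min _ [seq v i + g i | i <- enum I & z i != 0].
  rewrite -size_eq0 size_map size_filter -lt0n -has_count; apply/hasP.
  exists i0; rewrite ?mem_enum//; apply: contraNneq zi0 => ->; exact/eqP/hahn_coef0.
case/mapP => i; rewrite mem_filter => /andP[zi _] hE hle.
have [zv zv0] := vE _ zi.
have hz j : above (z j) (h - g j).
  move=> k; rewrite gam_ltrBr => kh; apply/eqP; apply: contraTT kh => zk.
  have zj : z j != 0 by apply: contraNneq zk => ->; exact/eqP/hahn_coef0.
  rewrite -gam_leNgt; apply: (@le_trans _ _ (v j + g j)).
    by apply: hle; apply/mapP; exists j => //; rewrite mem_filter zj mem_enum.
  rewrite gam_lerD2r gam_leNgt; apply: contra zk => kv.
  by rewrite (vE _ zj).1.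
have hm : h <= m.
  apply: le_trans km; rewrite gam_leNgt; apply: contra zi0 => hk.
  by apply/eqP/hz; rewrite gam_ltrBr.
suff zi1 : c (z i) (h - g i) = 0 by move: zv0; rewrite -(addrK (g i) (v i)) -hE zi1 eqxx.
apply: (@lead_indep h (fun i => c (z i) (h - g i))) => [j|]; first exact: zB.
rewrite -[RHS](z0 h hm) hahn_coef_sum; apply: eq_bigr => j _.
by rewrite -coefM_lead// addrC subrK.
Qed.

(** Call m reached if some combination of the e i agrees with y up to m.  By
    series_unique the combinations that reach different m agree where they
    overlap, so they glue to coefficients w; each w i has a well-ordered support,
    because below any of its points it is a coefficient of one approximation.
    If w missed y, the leading term of the difference could be
    corrected by Ylead, so its value would be reached, which is absurd. *)
Lemma series_span (Y : D -> Prop) :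
    (forall x y, Y x -> Y y -> Y (x - y)) ->
    (forall z, coefs_in z -> Y (\sum_i e i * z i)) ->
    (forall y k, Y y -> above y k -> exists2 b : I -> A,
       (forall i, B (k - g i) (b i)) & c y k = \sum_i c (e i) (g i) * b i) ->
  forall y, Y y -> exists2 z, coefs_in z & y = \sum_i e i * z i.
Proof.
move=> YB Ye Ylead y Yy.
pose approx m z := coefs_in z /\ forall k, k <= m -> c (y - \sum_i e i * z i) k = 0.
have diffE z z' : \sum_i e i * (z' i - z i) =
    (y - \sum_i e i * z i) - (y - \sum_i e i * z' i).
  rewrite opprB addrC addrA subrK -sumrB.
  by apply: eq_bigr => i _; rewrite mulrBr.
have agree m m' z z' i k : approx m z -> approx m' z' -> m <= m' ->
    k + g i <= m -> c (z i) k = c (z' i) k.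
  move=> [zB zm] [z'B zm'] mm' km; apply/eqP; rewrite eq_sym -subr_eq0.
  rewrite -(hahn_coefB hD); apply/eqP.
  apply: (@series_unique (fun i => z' i - z i) m) km => [j l|l lm].
    by rewrite (hahn_coefB hD); apply: BB.
  by rewrite diffE (hahn_coefB hD) zm// zm' ?subr0// (le_trans lm).
have /choice[Z ZP] : forall m, exists z, (exists z', approx m z') -> approx m z.
  move=> m; have [[z zP]|nz] := pselect (exists z', approx m z'); first by exists z.
  by exists (fun=> 0) => /nz.
pose w0 i k := if `[< exists z, approx (k + g i) z >] then c (Z (k + g i) i) k else 0.
have w0E m z i k : approx m z -> k + g i <= m -> w0 i k = c (z i) k.
  move=> mz km; rewrite /w0; case: asboolP => [/ZP kZ|[]]; first exact: agree kZ mz km _.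
  by case: mz => zB mz; exists z; split=> // l lk; apply: mz; exact: le_trans km.
have /choice[w wE] : forall i, exists x, c x =1 w0 i.
  move=> i; apply: (hahn_build hD) => [k|].
    rewrite /w0; case: asboolP => [/ZP[zB _]|_]; [exact/BH/zB|exact: hahn_mem0].
  apply/well_orderedP => X Xw [k Xk]; pose z := Z (k + g i).
  have zP : approx (k + g i) z.
    by apply: ZP; have := Xw _ Xk; rewrite /= inE /w0; case: asboolP; rewrite ?eqxx.
  have /well_orderedP/(_ (X `&` [set l | l <= k])%classic) := hahn_wo hD (z i).
  case=> [l [Xl lk]||l [Xl lk] lle].
  - have := Xw _ Xl; rewrite /= !inE (w0E _ _ _ _ zP) ?gam_lerD2r//.
  - by exists k; split=> //=; exact: lexx.
  exists l => // h Xh; have [hk|] := boolP (h <= k); first exact: lle.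
  by rewrite -gam_ltNge => /ltW; apply: le_trans.
have wB : coefs_in w.
  by move=> i k; rewrite wE /w0; case: asboolP => [/ZP[zB _]|_].
have wP m z : approx m z -> approx m w.
  move=> mz; split=> // k km; case: (mz) => zB /(_ k km) z0.
  have : c (\sum_i e i * (z i - w i)) k = 0.
    rewrite hahn_coef_sum big1// => i _; apply: coefM_eq0 => h.
    have [/eg ->|] := boolP (h < g i); first by left.
    rewrite -gam_leNgt => gh; right; rewrite (hahn_coefB hD) wE (w0E m z i _ mz) ?subrr//.
    apply: le_trans km; rewrite -[leRHS](subrK h) addrC [leRHS]addrC.
    exact: ler_translate.
  by rewrite diffE (hahn_coefB hD) z0 subr0.
exists w => //; apply/eqP; rewrite -subr_eq0; apply/negPn/negP.
set r := _ - _ => /lead_exists[m rm]; have Yr : Y r by apply: YB => //; exact: Ye.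
have [b bB bE] := Ylead _ _ Yr rm.
have /choice[u uE] : forall i, exists x,
    forall k, c x k = if k == m - g i then b i else 0.
  by move=> i; apply: hahn_monomial; exact/BH/bB.
have um i : above (u i) (m - g i).
  by move=> k /lt_eqF; rewrite uE => ->.
have uB i k : B k (c (u i) k) by rewrite uE; case: eqP => [->|].
suff /wP[_ /(_ m (lexx m))-> /eqP//] : approx m (fun i => w i - (- u i)).
split=> [i k|k].
  rewrite (hahn_coefB hD) hahn_coefN; apply: BB; first exact: wB.
  by rewrite -[- _]sub0r; apply: BB.
have -> : y - \sum_i e i * (w i - - u i) = r - \sum_i e i * u i.
  rewrite /r -addrA -opprD -big_split; congr (_ - _).
  by apply: eq_bigr => i _; rewrite opprK mulrDr.
rewrite le_eqVlt => /orP[/eqP->|km].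
  rewrite (hahn_coefB hD) bE hahn_coef_sum; apply/eqP; rewrite subr_eq0; apply/eqP.
  apply: eq_bigr => i _; have := coefM_lead (@eg i) (@um i).
  by rewrite uE eqxx [g i + _]addrC subrK.
rewrite (hahn_coefB hD) rm// hahn_coef_sum big1 ?subr0// => i _.
have := aboveM (@eg i) (@um i); rewrite addrC subrK; exact.
Qed.

End Series.

Lemma hahn_memB g a b : H g a -> H g b -> H g (a - b).
Proof.
move=> /hahn_monomial[x xE] /hahn_monomial[y yE].
have := hahn_mem hD (x - y) g.
by rewrite (hahn_coefB hD) xE yE eqxx.
Qed.

Lemma coefM_monol x y g b k :
  (forall h, c x h = if h == g then b else 0) -> c (x * y) (g + k) = b * c y k.
Proof.
move=> xE; rewrite (hahn_coefM hD) (@convE _ _ [set g]%classic).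
  by rewrite fsbig_set1 xE eqxx [g + k]addrC addrK.
by move=> h [+ _]; rewrite xE /=; case: (h =P g) => //; rewrite eqxx.
Qed.

Lemma coefM_monor x y g b k :
  (forall h, c x h = if h == g then b else 0) -> c (y * x) (k + g) = c y k * b.
Proof.
move=> xE; rewrite (hahn_coefM hD) (@convE _ _ [set k]%classic).
  by rewrite fsbig_set1 [k + g]addrC addrK xE eqxx.
move=> h [_]; rewrite xE /=; case: (_ =P g) => [/eqP|_]; last by rewrite eqxx.
by rewrite subr_eq addrC => /eqP/addrI ->.
Qed.

(** A right inverse of x is obtained by approximating 1 by x * z: the hypothesis
    says that the coefficient of z needed to correct a leading term is allowed
    at its place. *)
Lemma hahn_division_ring : division_ring A ->
    (forall g h a b, a != 0 -> H g a -> H h (a * b) -> H (h - g) b) ->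
  division_ring D.
Proof.
move=> divA HV; have rinv x : x != 0 -> exists y, x * y = 1.
  move=> /[dup] x0 /lead_exists[m xm xm0].
  have [b [xb bx]] := divA _ xm0.
  have lead_inj k (a : unit -> A) : (forall i, H (k - m) (a i)) ->
      \sum_i c x m * a i = 0 -> forall i, a i = 0.
    rewrite (bigD1 tt)//= big1 => [|[]//]; rewrite addr0 => _ xa [].
    by rewrite -[a tt]mul1r -bx -mulrA xa mulr0.
  have [//|//|y k _ yk||z _ ->] := @series_span H (fun _ _ => id) hahn_mem0
      hahn_memB unit (fun=> x) (fun=> m) (fun=> xm) lead_inj (fun=> True) _ _ _ 1.
  - exists (fun=> b * c y k); last first.
      by rewrite (bigD1 tt)//= big1 => [|[]//]; rewrite addr0 mulrA xb mul1r.
    move=> _; apply: HV xm0 (hahn_mem hD x m) _.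
    by rewrite mulrA xb mul1r; exact: (hahn_mem hD).
  - by [].
  - by exists (z tt); rewrite (bigD1 tt)//= big1 ?addr0// => -[].
move=> x /rinv[y xy]; exists y; split=> //.
have [w yw] : exists w, y * w = 1.
  by apply: rinv; apply/eqP => y0; move/eqP: xy; rewrite y0 mulr0 eq_sym oner_eq0.
by rewrite -[x]mulr1 -{1}yw [x * _]mulrA xy mul1r yw.
Qed.

End HahnRing.

(** * Galois subfields of a central division algebra *)

Section BasisFamily.
Variables (F : fieldType) (A : falgType F).

Lemma eq_fam_indep (E : fieldType) (D : nzRingType) (z z' : {rmorphism E -> D})
    (I : finType) (b : I -> D) : z =1 z' -> fam_indep z b -> fam_indep z' b.
Proof. by move=> zz bI e e0; apply: bI; rewrite -[RHS]e0; apply: eq_bigr => i _; rewrite zz. Qed.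

Lemma eq_fam_spans (E : fieldType) (D : nzRingType) (z z' : {rmorphism E -> D})
    Y (I : finType) (b : I -> D) : z =1 z' -> fam_spans z Y b -> fam_spans z' Y b.
Proof.
move=> zz bS y /bS[e ->]; exists e.
by apply: eq_bigr => i _; rewrite zz.
Qed.

Definition vfam (V : {vspace A}) (j : 'I_(\dim V)) : A := (vbasis V)`_j.

Arguments vfam V j : clear implicits.

Lemma vfam_mem (V : {vspace A}) j : vfam V j \in V.
Proof. by apply: vbasis_mem; rewrite mem_nth ?size_tuple. Qed.

Lemma vfam_spans (V : {vspace A}) : fam_spans (in_alg A) (fun a => a \in V) (vfam V).
Proof.
move=> a /coord_vbasis ->; exists (fun j => coord (vbasis V) j a).
by apply: eq_bigr => j _; rewrite mulr_algl.
Qed.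

Lemma vfam_indep (V : {vspace A}) : fam_indep (in_alg A) (vfam V).
Proof.
move=> e e0; have /freeP vI := basis_free (vbasisP V); apply: vI.
by rewrite -[RHS]e0; apply: eq_bigr => j _; rewrite mulr_algl.
Qed.

Lemma fam_indep_dim (I : finType) (b : I -> A) :
  fam_indep (in_alg A) b -> (#|I| <= \dim {:A})%N.
Proof.
move=> bI; rewrite -[\dim _]card_ord.
by apply: (fam_indep_le_spans _ bI (@vfam_spans fullv)) => i; exact: memvf.
Qed.

Lemma fam_spans_dim (I : finType) (b : I -> A) (V : {vspace A}) :
  fam_spans (in_alg A) (fun a => a \in V) b -> (\dim V <= #|I|)%N.
Proof.
move=> bS; rewrite -[\dim V]card_ord.
by apply: (fam_indep_le_spans _ (@vfam_indep V) bS) => i; exact: vfam_mem.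
Qed.

End BasisFamily.

Arguments vfam {F A} V j.

Lemma card_gal (E : fieldType) (L : splittingFieldType E) :
  galois 1 {:L} -> #|{: gal_of {:L}}| = \dim {:L}.
Proof.
move=> galL; have := galois_dim galL; rewrite dimv1 divn1 => ->.
by rewrite -cardsT; apply: eq_card => t; rewrite mem_gal1 inE.
Qed.

Lemma division_mulI (D : nzRingType) (a : D) :
  division_ring D -> a != 0 -> injective ( *%R a).
Proof.
move=> divD /divD[b [_ ba]] x y /(congr1 ( *%R b)).
by rewrite !mulrA ba !mul1r.
Qed.

Lemma division_unit (A : unitRingType) (a : A) :
  division_ring A -> a != 0 -> a \is a GRing.unit.
Proof. by move=> divA /divA[b [ab ba]]; apply/unitrP; exists b. Qed.

Section GaloisSubfield.
Variables (F : fieldType) (A : falgType F) (K : splittingFieldType F).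
Variable iota : 'AHom(K, A).

Lemma iota_alg (e : F) : iota e%:A = e%:A.
Proof. by rewrite linearZ rmorph1. Qed.

Lemma iota_algC (e : F) (a : A) : iota e%:A * a = a * iota e%:A.
Proof. by rewrite iota_alg mulr_algl mulr_algr. Qed.

Lemma mem_cent (a : A) : a \in 'C(iota @: fullv)%VS <-> cent iota a.
Proof.
split=> [/centvP aC l|aC]; first by rewrite aC// memv_img ?memvf.
by apply/centvP => _ /memv_imgP[l _ ->]; rewrite aC.
Qed.

Lemma twisted1 (a : A) : twisted iota 1%g a <-> cent iota a.
Proof. by split=> aC l; have := aC l; rewrite gal_id. Qed.

Hypotheses (divA : division_ring A) (ZA : ('Z({:A}) = 1)%VS) (galK : galois 1 {:K}).

Lemma central_iota (a : A) : (forall b, a * b = b * a) -> exists e : F, a = iota e%:A.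
Proof.
move=> aC; have : a \in 'Z({:A})%VS by rewrite memv_cap memvf; apply/centvP => y _.
by rewrite ZA => /vlineP[e ->]; exists e; rewrite iota_alg.
Qed.

Lemma skolem_noether : exists d : gal_of {:K} -> A,
  (forall t, d t != 0) /\ (forall t, twisted iota t (d t)).
Proof.
have /choice[d dP] : forall t : gal_of {:K}, exists a, a != 0 /\ twisted iota t a.
  by move=> t; have [a] := twisted_exists galK iota_algC divA central_iota t; exists a.
by exists d; split=> t; have [] := dP t.
Qed.

(** A is the direct sum of [K : F] cosets of the centralizer of K. *)
Lemma galois_centralizer_dim :
  (\dim {:K} * \dim 'C(iota @: {:K})%VS = \dim {:A})%N.
Proof.
have [d [d0 dt]] := skolem_noether; set C := 'C(_)%VS.
have zE : (iota \o in_alg K)%FUN =1 in_alg A by move=> e /=; rewrite iota_alg.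
have wC j : cent iota (vfam C j) by apply/mem_cent; exact: vfam_mem.
have wI := twisted_fam_indep galK iota_algC divA dt d0 wC
  (eq_fam_indep (fsym zE) (@vfam_indep _ _ C)).
have wS : fam_spans (iota \o in_alg K)%FUN (cent iota) (vfam C).
  by apply: eq_fam_spans (fsym zE) _ => y /mem_cent; exact: vfam_spans.
have {}wS := twisted_fam_spans galK iota_algC divA dt d0 wS.
have := fam_indep_dim (eq_fam_indep zE wI).
have : (\dim {:A} <= #|{: gal_of {:K} * 'I_(\dim C)}|)%N.
  by apply: (fam_spans_dim (eq_fam_spans zE _)) => y _; exact: wS.
rewrite card_prod card_ord card_gal// => le1 le2.
by apply/eqP; rewrite eqn_leq le1 le2.
Qed.

End GaloisSubfield.

(** * Series graded by a Galois group: centre and bases *)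

Section CrossedHahn.
Variables (F : fieldType) (A : falgType F) (K : splittingFieldType F).
Variables (iota : 'AHom(K, A)) (Gam : orderedZmodType).
Variable eps : Gam -> gal_of {:K}.
Hypothesis epsD : {morph eps : g h / g + h >-> (g * h)%g}.
Let H g a := twisted iota (eps g) a.
Variables (D : nzRingType) (c : D -> Gam -> A) (hD : hahn_ring H c).
Hypotheses (divA : division_ring A) (ZA : ('Z({:A}) = 1)%VS)
  (galK : galois 1 {:K}) (eps_surj : forall s, exists g, eps g = s).
Implicit Types (g h k : Gam) (x y : D).

Lemma eps0 : eps 0 = 1%g.
Proof. by apply: (mulgI (eps 0)); rewrite -epsD addr0 mulg1. Qed.

Lemma epsB1 g h : (eps (g - h) == 1%g) = (eps g == eps h).
Proof.
have -> : eps g = (eps (g - h) * eps h)%g by rewrite -epsD subrK.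
by rewrite -{2}[eps h]mul1g; apply/eqP/eqP => [->//|/mulIg].
Qed.

Lemma crossed_hahn_division_ring : division_ring D.
Proof.
apply: (hahn_division_ring hD divA) => g h a b a0 ga hab l.
pose l' := ((eps g)^-1)%g l.
have lE : l = eps g l' by rewrite -galM ?memvf// mulVg gal_id.
have -> : eps (h - g) l = eps h l'.
  by rewrite lE -galM ?memvf// -epsD addrC subrK.
by apply: (division_mulI divA a0); rewrite mulrA [RHS]mulrA -hab lE -ga mulrA.
Qed.

(** By crossed_hahn_center, these are the possible coefficients at g of central
    elements, so the centre is F((ker eps)). *)
Definition base_coef g (a : A) : Prop := a \in 1%VS /\ (a != 0 -> eps g = 1%g).

Lemma base_coef0 g : base_coef g 0.
Proof. by split; [exact: mem0v|rewrite eqxx]. Qed.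

Lemma base_coefB g a b : base_coef g a -> base_coef g b -> base_coef g (a - b).
Proof.
move=> [a1 ga] [b1 gb]; split=> [|ab]; first exact: rpredB.
have [/eqP a0|/ga//] := boolP (a == 0).
by apply: gb; apply: contraNneq ab => ->; rewrite a0 subrr.
Qed.

Lemma base_coefH g a : base_coef g a -> H g a.
Proof.
case=> /vlineP[e ->] g1 l; rewrite mulr_algl mulr_algr.
have [->|e0] := eqVneq e 0; first by rewrite !scale0r.
by rewrite g1 ?gal_id// scaler_eq0 oner_eq0 orbF.
Qed.

Lemma base_coefC g a b : base_coef g a -> a * b = b * a.
Proof. by case=> /vlineP[e ->] _; rewrite mulr_algl mulr_algr. Qed.

Lemma centralA (a : A) : (forall s b, twisted iota s b -> a * b = b * a) -> a \in 1%VS.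
Proof.
move=> aC; rewrite -ZA memv_cap memvf; apply/centvP => b _.
have [y yt ->] := twisted_sum galK (@iota_algC _ _ _ iota) b.
by rewrite mulr_sumr mulr_suml; apply: eq_bigr => s _; apply: aC (yt s).
Qed.

(** A central series commutes with all monomials, so its coefficients commute
    with every homogeneous element of A, hence with A; and a nonzero
    scalar lies in A_s only for s = 1. *)
Lemma crossed_hahn_center x :
  (forall y, x * y = y * x) <-> (forall g, base_coef g (c x g)).
Proof.
split=> [xC g|xB y]; last first.
  apply: (hahn_inj hD) => k; rewrite !(hahn_coefM hD).
  rewrite /conv [RHS](reindex_fsbigT (fun g => k - g)) /=; last first.
    by exists (fun g => k - g) => g; rewrite opprB addrC subrK.
  apply: eq_fsbigr => g _; rewrite opprB [k + (g - k)]addrC subrK.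
  exact: base_coefC (xB g).
have com h b : H h b -> c x g * b = b * c x g.
  move=> /(hahn_monomial hD)[m mE].
  by rewrite -(coefM_monor hD _ _ mE) xC addrC (coefM_monol hD _ _ mE).
have x1 : c x g \in 1%VS.
  by apply: centralA => s b; have [h <-] := eps_surj s; exact: com.
split=> // x0; apply/eqP/gal_eqP => l _; rewrite gal_id; apply: (fmorph_inj iota).
apply: (division_mulI divA x0); rewrite -(hahn_mem hD x g l).
by have /vlineP[e ->] := x1; rewrite mulr_algl mulr_algr.
Qed.

(** Values modulo ker eps are elements of the Galois group, so series x_s with
    one value in each of several classes, times series w_j of value 0, have
    independent leading terms over F((ker eps)) as soon as the leading
    coefficients of the w_j are independent over F. *)
Section CosetFamily.
Variables (S : {set gal_of {:K}}) (xs : gal_of {:K} -> D) (gs : gal_of {:K} -> Gam).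
Variables (J : finType) (w : J -> D).
Hypotheses (gsE : forall s, s \in S -> eps (gs s) = s)
  (xs_above : forall s, s \in S -> above c (xs s) (gs s))
  (xs_lead : forall s, s \in S -> c (xs s) (gs s) != 0)
  (w_above : forall j, above c (w j) 0)
  (w_lead : fam_indep (in_alg A) (fun j => c (w j) 0)).

Definition coset_idx : finType := ({s | s \in S} * J)%type.
Definition coset_fam (p : coset_idx) : D := xs (val p.1) * w p.2.
Let gp (p : coset_idx) := gs (val p.1).

Let fam_above p : above c (coset_fam p) (gp p).
Proof. by rewrite -[gp p]addr0; exact: (aboveM hD (xs_above (valP p.1)) (w_above p.2)). Qed.

Let fam_lead p : c (coset_fam p) (gp p) = c (xs (val p.1)) (gp p) * c (w p.2) 0.
Proof.
by rewrite -[in LHS](addr0 (gp p)); exact: (coefM_lead hD (xs_above (valP p.1)) (w_above p.2)).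
Qed.

Let lead_sum k (b : coset_idx -> A) s (sS : s \in S) :
    (forall p, base_coef (k - gp p) (b p)) -> eps k = s ->
  \sum_p c (coset_fam p) (gp p) * b p =
    c (xs s) (gs s) * \sum_j b (Sub s sS, j) * c (w j) 0.
Proof.
move=> bB ks; transitivity (\sum_(t : {s | s \in S}) \sum_j
    c (coset_fam (t, j)) (gp (t, j)) * b (t, j)).
  by rewrite pair_big; apply: eq_bigr => -[].
rewrite (bigD1 (Sub s sS))//= [X in _ + X]big1 ?addr0 => [|t ts].
  rewrite mulr_sumr; apply: eq_bigr => j _; rewrite fam_lead -mulrA.
  by rewrite (base_coefC _ (bB _)).
rewrite big1// => j _; have [_ b1] := bB (t, j).
have [->|/b1/eqP] := eqVneq (b (t, j)) 0; first by rewrite mulr0.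
rewrite epsB1 /gp /= (gsE (valP t)) ks => /eqP st.
by case/eqP: ts; apply: val_inj; rewrite /= st.
Qed.

Let lead_indep k (b : coset_idx -> A) : (forall p, base_coef (k - gp p) (b p)) ->
  \sum_p c (coset_fam p) (gp p) * b p = 0 -> forall p, b p = 0.
Proof.
move=> bB; have [sS|sS _ p] := boolP (eps k \in S); last first.
  have [_ b1] := bB p; apply/eqP; apply: contraNT sS => /b1/eqP.
  by rewrite epsB1 /gp (gsE (valP p.1)) => /eqP ->; exact: valP.
rewrite (lead_sum sS bB erefl) => lead0 [t j].
have sum0 : \sum_j b (Sub (eps k) sS, j) * c (w j) 0 = 0.
  by apply: (division_mulI divA (xs_lead sS)); rewrite lead0 mulr0.
have [_ b1] := bB (t, j); apply/eqP/negPn/negP => btj.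
have /eqP := b1 btj; rewrite epsB1 /gp /= (gsE (valP t)) => /eqP kt.
have tE : t = Sub (eps k) sS by apply: val_inj; rewrite /= kt.
have /choice[e eE] : forall j, exists e : F, b (Sub (eps k) sS, j) = e%:A.
  by move=> i; have [/vlineP[e ->] _] := bB (Sub (eps k) sS, i); exists e.
have e0 : forall i, e i = 0.
  by apply: w_lead; rewrite -[RHS]sum0; apply: eq_bigr => i _; rewrite eE.
by move/eqP: btj; apply; rewrite tE eE e0 scale0r.
Qed.

Lemma coset_fam_unique (z : coset_idx -> D) :
  (forall p g, base_coef g (c (z p) g)) -> \sum_p coset_fam p * z p = 0 ->
  forall p, z p = 0.
Proof.
move=> zB z0 p; apply: (hahn_inj hD) => k; rewrite (hahn_coef0 hD).
apply: (series_unique hD fam_above lead_indep zB _ (lexx (k + gp p))).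
by move=> h _; rewrite z0 (hahn_coef0 hD).
Qed.

(** The case of series_span with coefficients in the centre.  The family spans
    any Y whose leading coefficients in the class s are those of x_s times
    combinations of those of the w_j.  Applied to a subfield Y, this is the
    equality of its degree with ramification index times residue degree. *)
Lemma coset_fam_series (Y : D -> Prop) :
    (forall x y, Y x -> Y y -> Y (x - y)) ->
    (forall p z, (forall y, z * y = y * z) -> Y (coset_fam p * z)) ->
    (forall y k, Y y -> above c y k -> c y k != 0 -> eps k \in S /\
       exists e : J -> F, c y k = c (xs (eps k)) (gs (eps k)) * \sum_j (e j)%:A * c (w j) 0) ->
  forall y, Y y -> exists2 z : coset_idx -> D,
    (forall p, (forall x, z p * x = x * z p)) & y = \sum_p coset_fam p * z p.
Proof.
move=> YB YM Ylead y Yy.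
have [z zB|x k Yx xk|z zB ->] := series_span hD base_coefH base_coef0 base_coefB
  fam_above lead_indep YB _ _ Yy; last first.
- by exists z => // p x; apply: (crossed_hahn_center _).2.
- have [x0|/(Ylead _ _ Yx xk)[kS [e eE]]] := eqVneq (c x k) 0.
    exists (fun=> 0) => [p|]; first exact: base_coef0.
    by rewrite big1// => p _; rewrite mulr0.
  pose b (p : coset_idx) : A := if val p.1 == eps k then (e p.2)%:A else 0.
  have bB p : base_coef (k - gp p) (b p).
    rewrite /b; case: eqP => [pk|_]; last exact: base_coef0.
    split=> [|_]; first by apply/vlineP; exists (e p.2).
    by apply/eqP; rewrite epsB1 /gp pk gsE.
  exists b => //; rewrite (lead_sum kS bB erefl) eE; congr (_ * _).
  by apply: eq_bigr => j _; rewrite /b /= eqxx.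
have Y0 : Y 0 by rewrite -(subrr y); apply: YB.
have YD x x' : Y x -> Y x' -> Y (x + x').
  by move=> Yx Yx'; rewrite -[x']opprK -[- x']sub0r; exact: (YB _ _ Yx (YB _ _ Y0 Yx')).
apply: (big_ind Y) => // p _; apply: YM.
exact: (crossed_hahn_center _).2.
Qed.

Lemma card_coset_idx : #|{: coset_idx}| = (#|S| * #|J|)%N.
Proof. by rewrite card_prod card_sig. Qed.

End CosetFamily.

End CrossedHahn.

(** Among the subspaces contained in S, one of maximal dimension is S. *)
Lemma vspace_of_pred (F : fieldType) (A : vectType F) (S : A -> Prop) :
    S 0 -> (forall a b, S a -> S b -> S (a + b)) -> (forall k a, S a -> S (k *: a)) ->
  exists U : {vspace A}, forall a, a \in U <-> S a.
Proof.
move=> S0 SD SZ; pose P n := `[< exists2 U : {vspace A}, \dim U = n & forall a, a \in U -> S a >].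
have P0 : exists n, P n.
  exists 0%N; apply/asboolP; exists 0%VS; first exact: dimv0.
  by move=> a; rewrite memv0 => /eqP ->.
have Pmax n : P n -> (n <= \dim {:A})%N by move=> /asboolP[U <- _]; exact/dimvS/subvf.
have [_ /asboolP[U <- US] Umax] := ex_maxnP P0 Pmax.
exists U => a; split=> [/US//|Sa]; apply: contrapT => /negP aU.
have : P (\dim (U + <[a]>)%VS).
  apply/asboolP; exists (U + <[a]>)%VS => // _ /memv_addP[v vU [_ /vlineP[k ->] ->]].
  by apply: SD; [exact: US|exact: SZ].
move/Umax; rewrite leqNgt => /negP; apply.
rewrite ltn_neqAle dimvS ?addvSl// andbT; apply: contra aU => /eqP dimU.
have /eqP -> : U == (U + <[a]>)%VS by rewrite -(dimv_leqif_eq (addvSl _ _)) dimU.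
exact: (subvP (addvSr _ _) _ (memv_line a)).
Qed.

Section CrossedHahnBasis.
Variables (F : fieldType) (A : falgType F) (K : splittingFieldType F).
Variables (iota : 'AHom(K, A)) (Gam : orderedZmodType).
Variable eps : Gam -> gal_of {:K}.
Hypothesis epsD : {morph eps : g h / g + h >-> (g * h)%g}.
Let H g a := twisted iota (eps g) a.
Variables (D : nzRingType) (c : D -> Gam -> A) (hD : hahn_ring H c).
Hypotheses (divA : division_ring A) (ZA : ('Z({:A}) = 1)%VS)
  (galK : galois 1 {:K}) (eps_surj : forall s, exists g, eps g = s).
Implicit Types (g h k : Gam) (x y : D).

(** Monomials suffice: one of each class modulo ker eps, times a basis of the
    centralizer of K.  Their number is that of galois_centralizer_dim. *)
Lemma crossed_hahn_basis : exists (I : finType) (b : I -> D),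
  [/\ #|I| = \dim {:A},
      (forall y, exists2 z : I -> D, (forall p x, z p * x = x * z p) &
         y = \sum_p b p * z p)
    & (forall z : I -> D, (forall p x, z p * x = x * z p) ->
         \sum_p b p * z p = 0 -> forall p, z p = 0)].
Proof.
set C := 'C(iota @: fullv)%VS.
have [d [d0 dt]] := skolem_noether iota divA ZA galK.
have [gs gsE] := choice eps_surj.
have /choice[xs xsE] : forall s, exists x, forall k, c x k = if k == gs s then d s else 0.
  by move=> s; apply: (hahn_monomial hD); rewrite /H gsE; exact: dt.
have /choice[w wE] : forall j, exists x, forall k, c x k = if k == 0 then vfam C j else 0.
  move=> j; apply: (hahn_monomial hD); rewrite /H (eps0 epsD).
  by apply/twisted1/mem_cent; exact: vfam_mem.
pose S := [set: gal_of {:K}]%SET.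
have gsS s : s \in S -> eps (gs s) = s by [].
have xs_above s : s \in S -> above c (xs s) (gs s).
  by move=> _ k /lt_eqF; rewrite xsE => ->.
have xs_lead s : s \in S -> c (xs s) (gs s) != 0 by rewrite xsE eqxx d0.
have w_above j : above c (w j) 0 by move=> k /lt_eqF; rewrite wE => ->.
have wE0 j : c (w j) 0 = vfam C j by rewrite wE eqxx.
have w_lead : fam_indep (in_alg A) (fun j => c (w j) 0).
  move=> e e0; apply: (@vfam_indep _ _ C e); rewrite -[RHS]e0.
  by apply: eq_bigr => j _; rewrite wE0.
exists (coset_idx S 'I_(\dim C)), (coset_fam xs w); split=> [|y|z zC].
- rewrite card_coset_idx cardsT card_ord -(galois_centralizer_dim iota divA ZA galK).
  by rewrite card_gal.
- apply: (coset_fam_series epsD hD divA ZA galK eps_surj gsS xs_above xs_lead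
    w_above w_lead (Y := fun=> True)) => // x k _ _ xk0; split; first by rewrite inE.
  have [a /mem_cent/vfam_spans[e ->] ->] :=
    twisted_coset divA dt d0 (hahn_mem hD x k).
  exists e; rewrite xsE eqxx; congr (_ * _).
  by apply: eq_bigr => j _; rewrite wE0.
apply: (coset_fam_unique epsD hD divA gsS xs_above xs_lead w_above w_lead) => // p.
exact: (proj1 (crossed_hahn_center hD divA ZA galK eps_surj (z p)) (zC p)).
Qed.

End CrossedHahnBasis.

(** * The residue field of a Galois maximal subfield *)

Section Residue.
Variables (F : fieldType) (A : falgType F) (K : splittingFieldType F).
Variables (iota : 'AHom(K, A)) (Gam : orderedZmodType).
Variable eps : Gam -> gal_of {:K}.
Hypothesis epsD : {morph eps : g h / g + h >-> (g * h)%g}.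
Let H g a := twisted iota (eps g) a.
Variables (D : nzRingType) (c : D -> Gam -> A) (hD : hahn_ring H c).
Hypotheses (divA : division_ring A) (ZA : ('Z({:A}) = 1)%VS)
  (galK : galois 1 {:K}) (eps_surj : forall s, exists g, eps g = s).
Variables (d : nat) (dimA : \dim {:A} = (d ^ 2)%N)
  (pchar_d : forall p, p \in [pchar F] -> ~~ (p %| d)%N).
Variables (E : fieldType) (L : splittingFieldType E) (f : {rmorphism L -> D}).
Hypotheses (galL : galois 1 {:L})
  (rangeE : range (fun e : E => f e%:A) = @ring_center D)
  (maxM : maximal_commutative_subalgebra (range f)).
Implicit Types (g h k : Gam) (x y : D) (l : L) (a b : A).

Let divD : division_ring D := crossed_hahn_division_ring epsD hD divA.

Let centE (e : E) x : f e%:A * x = x * f e%:A.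
Proof.
have : range (fun e : E => f e%:A) (f e%:A) by exists e.
by rewrite rangeE; apply.
Qed.

Let centD x : (forall y, x * y = y * x) -> exists e : E, x = f e%:A.
Proof.
move=> xC; have : ring_center x by [].
by rewrite -rangeE => -[e _ <-]; exists e.
Qed.

(* If x centralizes M, the double centralizer of M and x is commutative, so it
   is M by maximality. *)
Let centM x : cent f x -> exists l, x = f l.
Proof.
move=> xC; pose S : set D := [set y | y = x \/ exists l, y = f l]%classic.
pose cen (T : set D) : set D := [set y | forall t, T t -> y * t = t * y]%classic.
have SS y : S y -> cen S y.
  move=> Sy t St; case: Sy => [->|[l ->]]; case: St => [->|[l' ->]] //.
  by rewrite -!rmorphM mulrC.
have NS y : cen (cen S) y -> cen S y by move=> yN t /SS; exact: yN.
have Nsub : commutative_subalgebra (cen (cen S)).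
  split=> [y yC t _|y y' yN yN' t tS|y y' yN yN' t tS|y y' yN yN'].
  - exact: yC.
  - by rewrite mulrBl mulrBr yN ?yN'.
  - by rewrite -mulrA yN'// mulrA yN// mulrA.
  - by apply: yN; exact: NS.
have SN t : S t -> cen (cen S) t by move=> St y yS; rewrite yS.
have [_ /(_ _ Nsub) NE] := maxM.
have : cen (cen S) x by apply: SN; left.
rewrite NE => [[l _ <-]|]; first by exists l.
by move=> _ [l _ <-]; apply: SN; right; exists l.
Qed.

(** M is its own centralizer, so decomposing D along M gives a basis of [M:Z]^2
    elements; crossed_hahn_basis gives one of d^2. *)
Lemma dim_crossed : \dim {:L} = d.
Proof.
have /choice[dt dtP] : forall t : gal_of {:L}, exists y, y != 0 /\ twisted f t y.
  by move=> t; have [y] := twisted_exists galL centE divD centD t; exists y.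
have dt0 t := (dtP t).1; have dtt t := (dtP t).2.
pose w := f \o vfam ({:L}%VS : {vspace L}).
have wC j : cent f (w j) by move=> l; rewrite -!rmorphM mulrC.
have wI : fam_indep (f \o in_alg L)%FUN w.
  move=> e e0; apply: (@vfam_indep _ _ fullv e).
  apply: (fmorph_inj f); rewrite rmorph0 -[RHS]e0 rmorph_sum.
  by apply: eq_bigr => j _; rewrite rmorphM.
have wS : fam_spans (f \o in_alg L)%FUN (cent f) w.
  move=> x /centM[l ->]; have [e ->] := vfam_spans (memvf l).
  by exists e; rewrite rmorph_sum; apply: eq_bigr => j _; rewrite rmorphM.
have fI := twisted_fam_indep galL centE divD dtt dt0 wC wI.
have fS := twisted_fam_spans galL centE divD dtt dt0 wS.
have [T [b [cardI bS bI]]] := crossed_hahn_basis epsD hD divA ZA galK eps_surj.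
have bS' : fam_spans (f \o in_alg L)%FUN (fun=> True) b.
  move=> x _; have [z zC ->] := bS x.
  have /choice[e eE] := fun p => centD (zC p).
  by exists e; apply: eq_bigr => p _; rewrite eE centE.
have bI' : fam_indep (f \o in_alg L)%FUN b.
  move=> e e0 p; apply/eqP; rewrite -(fmorph_eq0 (in_alg L)) -(fmorph_eq0 f); apply/eqP.
  apply: (bI (fun p => f (e p)%:A)) => [q x|]; first exact: centE.
  by rewrite -[RHS]e0; apply: eq_bigr => q _; rewrite centE.
have := fam_indep_le_spans (fun _ => I) fI bS'.
have := fam_indep_le_spans (fun _ => I) bI' fS.
rewrite card_prod card_ord card_gal// cardI dimA => le1 le2.
by apply/eqP; rewrite -(eqn_exp2r _ _ (isT : 0 < 2)%N) eqn_leq -mulnn le1 le2.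
Qed.

(* M contains the centre, so central monomials can be used to shift values. *)
Let base_elt g a : base_coef eps g a ->
  exists l, forall k, c (f l) k = if k == g then a else 0.
Proof.
move=> ga; have [x xE] := hahn_monomial hD (base_coefH iota ga).
have [y|e ex] := @centD x; last by exists e%:A; rewrite -ex.
move: y; apply/(crossed_hahn_center hD divA ZA galK eps_surj) => k.
by rewrite xE; case: eqP => [->|_] //; exact: base_coef0.
Qed.

Definition residue l a := above c (f l) 0 /\ c (f l) 0 = a.

Let residueB l l' a a' : residue l a -> residue l' a' -> residue (l - l') (a - a').
Proof.
move=> [la <-] [l'a <-]; split=> [k k0|]; rewrite rmorphB (hahn_coefB hD)//.
by rewrite la ?l'a ?subrr.
Qed.

Let residueM l l' a a' : residue l a -> residue l' a' -> residue (l * l') (a * a').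
Proof.
move=> [la <-] [l'a <-]; rewrite /residue rmorphM; split=> [k k0|].
  by apply: (aboveM hD la l'a); rewrite addr0.
by rewrite -(coefM_lead hD la l'a) addr0.
Qed.

Let residueZ (e : F) : exists l, residue l e%:A.
Proof.
have [|l lE] := @base_elt 0 e%:A.
  by split=> [|_]; [apply/vlineP; exists e|exact: eps0].
exists l; split=> [k /lt_eqF|]; rewrite lE ?eqxx//.
by move=> ->.
Qed.

Let residue_uniq l a a' : residue l a -> residue l a' -> a = a'.
Proof. by move=> [_ <-] [_ <-]. Qed.

Lemma residue_space : exists U : {vspace A}, forall a, a \in U <-> exists l, residue l a.
Proof.
apply: vspace_of_pred => [|a b [l la] [l' lb]|e a [l la]].
- by exists 0; split=> [k _|]; rewrite rmorph0 (hahn_coef0 hD).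
- have [l0 l00] := residueZ 0; exists (l - (l0 - l')).
  have -> : a + b = a - ((0 : F)%:A - b) by rewrite scale0r sub0r opprK.
  exact/residueB/residueB.
- by have [l' l'e] := residueZ e; exists (l' * l); rewrite -mulr_algl; exact: residueM.
Qed.

Let lead_inv l g : above c (f l) g -> c (f l) g != 0 ->
  above c (f l^-1) (- g) /\ c (f l) g * c (f l^-1) (- g) = 1.
Proof.
move=> lg lg0; have l0 : l != 0.
  by apply: contraNneq lg0 => ->; rewrite rmorph0 (hahn_coef0 hD).
have lV : f l * f l^-1 = 1 by rewrite -rmorphM mulfV// rmorph1.
have [h l'h l'h0] : exists2 h, above c (f l^-1) h & c (f l^-1) h != 0.
  by apply: (lead_exists hD); rewrite fmorph_eq0 invr_eq0.
have prod := coefM_lead hD lg l'h; rewrite lV (hahn_coef1 hD) in prod.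
have gh0 : g + h = 0.
  apply/eqP; apply: contraNT l'h0 => /negbTE gh0; move: prod; rewrite gh0 => prod.
  by apply/eqP/(division_mulI divA lg0); rewrite -prod mulr0.
have <- : h = - g by apply/eqP; rewrite -addr_eq0 addrC gh0.
by split=> //; rewrite -prod gh0 eqxx.
Qed.

(* Conjugation by an element y of the component of t maps the valuation ring of
   M into itself, as Gam is commutative; on residues it is conjugation by the
   leading coefficient of y. *)
Let galois_residue (t : gal_of {:L}) : exists2 e, e \is a GRing.unit &
  forall l a, residue l a -> residue (t l) (e^-1 * a * e).
Proof.
have [y y0 yt] := twisted_exists galL centE divD centD t.
have [m ym ym0] := lead_exists hD y0.
exists (c y m); first exact: division_unit.
move=> l a [l0 la]; have tl0 : above c (f (t l)) 0.
  have [->|tn0] := eqVneq (t l) 0; first by move=> k _; rewrite rmorph0 (hahn_coef0 hD).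
  have [h th th0] : exists2 h, above c (f (t l)) h & c (f (t l)) h != 0.
    by apply: (lead_exists hD); rewrite fmorph_eq0.
  have h0 : 0 <= h.
    rewrite gam_leNgt; apply: contra th0 => h0.
    apply/eqP/(division_mulI divA ym0); rewrite mulr0 -(coefM_lead hD ym th) -yt.
    by apply: (aboveM hD l0 ym); rewrite add0r -[ltRHS]addr0; apply: ltr_transl.
  by move=> k k0; apply: th; apply: lt_le_trans h0.
split=> //; apply: (division_mulI divA ym0).
rewrite -(coefM_lead hD ym tl0) -yt addrC (coefM_lead hD l0 ym) la.
by rewrite !mulrA mulrV ?mul1r//; exact: division_unit.
Qed.

(* If all conjugates of l have residue a, the trace of l has residue d a; it
   is central, and d is invertible in F. *)
Let residue_fixed l a : (forall t : gal_of {:L}, residue (t l) a) -> a \in 1%VS.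
Proof.
move=> la; have : galTrace 1 {:L} l \in 1%VS by apply: mem_galTrace (memvf _).
case/vlineP => e eE.
have aE : c (f (galTrace 1 {:L} l)) 0 = a *+ d.
  rewrite rmorph_sum (hahn_coef_sum hD) (eq_bigr (fun=> a)) => [|t _]; last first.
    by have [_ <-] := la t.
  by rewrite sumr_const -galois_dim// dimv1 divn1 dim_crossed.
have [ad _] : base_coef eps 0 (a *+ d).
  rewrite -aE eE; move: 0; apply/(crossed_hahn_center hD divA ZA galK eps_surj) => x.
  exact: centE.
have d0 : d%:R != 0 :> F.
  have d_gt0 : (0 < d)%N.
    by rewrite lt0n; apply: contraTneq (adim_gt0 {:A}%AS) => d0; rewrite dimA d0.
  rewrite natf_neq0_pchar; apply/pnatP => // p p_pr pd; rewrite inE /=; apply: contraL pd; exact: pchar_d.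
by move: ad; rewrite -scaler_nat rpredZeq (negbTE d0).
Qed.

(** What the proof retains of M: U is its residue field and S the image in
    Gal(K/F) of its value group; res_ramified is witnessed by leading
    coefficients of M, and the e t of res_galois by leading coefficients of
    elements that normalize M. *)
Record tame_residue (U : {vspace A}) (S : {set gal_of {:K}}) : Prop := {
  res1 : 1 \in U;
  resM : {in U &, forall a b, a * b \in U};
  resC : {in U &, commutative *%R};
  res_iota : {in U, forall a, cent iota a};
  res_dim : (d <= #|S| * \dim U)%N;
  res_ramified : forall s, s \in S ->
    exists b, [/\ b \is a GRing.unit, twisted iota s b & {in U, forall a, b * a = a * b}];
  res_galois : exists (T : finType) (e : T -> A),
    [/\ forall t, e t \is a GRing.unit,
        forall t, {in U, forall a, (e t)^-1 * a * e t \in U},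
        forall t t', exists t'', {in U, forall a,
          (e t')^-1 * ((e t)^-1 * a * e t) * e t' = (e t'')^-1 * a * e t''},
        exists t, {in U, forall a, (e t)^-1 * a * e t = a}
      & {in U, forall a, (forall t, (e t)^-1 * a * e t = a) -> a \in 1%VS}]
}.

Lemma crossed_tame_residue : exists U S, tame_residue U S.
Proof.
have [U UE] := residue_space.
pose S := [set s : gal_of {:K} |
  `[< exists l g, [/\ above c (f l) g, c (f l) g != 0 & eps g = s] >]]%SET.
exists U, S; split.
- by apply/UE; have [l] := residueZ 1; rewrite scale1r; exists l.
- by move=> a b /UE[l la] /UE[l' lb]; apply/UE; exists (l * l'); exact: residueM.
- move=> a b /UE[l la] /UE[l' lb]; apply: (@residue_uniq (l * l')); first exact: residueM.
  by rewrite mulrC; exact: residueM.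
- move=> a /UE[l [_ <-]]; apply/twisted1; rewrite -(eps0 epsD); exact: (hahn_mem hD).
- have /choice[ls lsP] : forall s, exists p : L * Gam, s \in S ->
      [/\ above c (f p.1) p.2, c (f p.1) p.2 != 0 & eps p.2 = s].
    move=> s; have [|_] := boolP (s \in S); last by exists (0, 0).
    by rewrite inE => /asboolP[l [g lg]]; exists (l, g).
  have /choice[w wP] : forall j, exists l, residue l (vfam U j).
    by move=> j; apply/UE; exact: vfam_mem.
  have gsE s : s \in S -> eps (ls s).2 = s by move=> /lsP[].
  have xs_above s : s \in S -> above c (f (ls s).1) (ls s).2 by move=> /lsP[].
  have xs_lead s : s \in S -> c (f (ls s).1) (ls s).2 != 0 by move=> /lsP[].
  have w_above j : above c (f (w j)) 0 by have [] := wP j.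
  have wE j : c (f (w j)) 0 = vfam U j by have [] := wP j.
  have w_lead : fam_indep (in_alg A) (fun j => c (f (w j)) 0).
    move=> e e0; apply: (@vfam_indep _ _ U e); rewrite -[RHS]e0.
    by apply: eq_bigr => j _; rewrite wE.
  pose Y y := exists l, y = f l.
  have YB x y : Y x -> Y y -> Y (x - y).
    by move=> [l ->] [l' ->]; exists (l - l'); rewrite rmorphB.
  pose fam := coset_fam (S := S) (fun s => f (ls s).1) (fun j => f (w j)).
  have famY p z : (forall y, z * y = y * z) -> Y (fam p * z).
    move=> /centD[e ->]; rewrite /fam /coset_fam -!rmorphM; by eexists.
  have Ylead y k : Y y -> above c y k -> c y k != 0 -> eps k \in S /\
      exists e : 'I_(\dim U) -> F, c y k =
        c (f (ls (eps k)).1) (ls (eps k)).2 * \sum_j (e j)%:A * c (f (w j)) 0.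
    move=> [l ->] lk lk0; have kS : eps k \in S.
      by rewrite inE; apply/asboolP; exists l, k.
    split=> //; have [l'g l'0 gE] := lsP _ kS.
    set l' := (ls _).1 in l'g l'0 *; set g := (ls _).2 in l'g l'0 gE *.
    have [l'V l'VE] := lead_inv l'g l'0.
    (* m shifts the value k of l to that of l', so that l'^-1 l m is integral. *)
    have [|m mE] := @base_elt (g - k) 1.
      split=> [|_]; first exact: memv_line.
      by apply/eqP; rewrite (epsB1 epsD) gE.
    have mg : above c (f m) (g - k) by move=> h /lt_eqF; rewrite mE => ->.
    have lm := aboveM hD lk mg; have lmE := coefM_lead hD lk mg.
    rewrite addrC subrK mE eqxx mulr1 in lm lmE.
    have r0 := aboveM hD l'V lm; have r0E := coefM_lead hD l'V lm.
    rewrite addNr lmE -!rmorphM in r0 r0E.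
    have /vfam_spans[e eE] : c (f l'^-1) (- g) * c (f l) k \in U.
      by apply/UE; exists (l'^-1 * (l * m)); split.
    exists e; transitivity (c (f l') g * (c (f l'^-1) (- g) * c (f l) k)).
      by rewrite mulrA l'VE mul1r.
    by rewrite eE; congr (_ * _); apply: eq_bigr => j _; rewrite wE.
  have famS : fam_spans (f \o in_alg L)%FUN Y fam.
    move=> y Yy; have [z zC ->] := coset_fam_series epsD hD divA ZA galK eps_surj
      gsE xs_above xs_lead w_above w_lead YB famY Ylead Yy.
    have /choice[e eE] := fun p => centD (zC p).
    by exists e; apply: eq_bigr => p _; rewrite eE centE.
  have LI : fam_indep (f \o in_alg L)%FUN (f \o vfam ({:L}%VS : {vspace L})).
    move=> e e0; apply: (@vfam_indep _ _ fullv e).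
    apply: (fmorph_inj f); rewrite rmorph0 -[RHS]e0 rmorph_sum.
    by apply: eq_bigr => j _; rewrite rmorphM.
  have LY i : Y ((f \o vfam ({:L}%VS : {vspace L})) i) by eexists.
  by have := fam_indep_le_spans LY LI famS; rewrite card_coset_idx !card_ord dim_crossed.
- move=> s; rewrite inE => /asboolP[l [g [lg lg0 <-]]]; exists (c (f l) g); split.
  + exact: division_unit.
  + exact: (hahn_mem hD).
  + move=> a /UE[l' [l'0 <-]].
    rewrite -(coefM_lead hD lg l'0) -(coefM_lead hD l'0 lg).
    by rewrite -!rmorphM mulrC addrC.
have /choice[e eP] : forall t : gal_of {:L}, exists e, e \is a GRing.unit /\
    forall l a, residue l a -> residue (t l) (e^-1 * a * e).
  by move=> t; have [e] := galois_residue t; exists e.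
exists (gal_of {:L} : finType), e; split=> [t|t a /UE[l la]|t t'||a /UE[l la] aE].
- exact: (eP t).1.
- by apply/UE; exists (t l); exact: (eP t).2.
- exists (t * t')%g => a /UE[l la].
  apply: (@residue_uniq ((t * t')%g l)); last exact: (eP _).2.
  by rewrite galM ?memvf//; apply: (eP _).2; exact: (eP _).2.
- exists 1%g => a /UE[l la]; apply: (@residue_uniq l) => //.
  by have := (eP 1%g).2 _ _ la; rewrite gal_id.
by apply: (@residue_fixed l) => t; rewrite -(aE t); exact: (eP t).2.
Qed.

End Residue.

(** * The Mal'cev-Neumann ring as a ring of series *)

Section MalcevNeumannHahn.
Variables (F : fieldType) (A : falgType F) (K : splittingFieldType F).
Variables (iota : 'AHom(K, A)) (Gam : orderedZmodType).
Variable eps : Gam -> gal_of {:K}.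
Hypothesis epsD : {morph eps : g h / g + h >-> (g * h)%g}.
Variable u : skolem_noether_choice iota.
Local Notation MN := (malcev_neumann epsD u).

(** Writing t^g u_(eps g) for a_g absorbs both the twist and the cocycle of the
    multiplication. *)
Definition untwisted_coef (r : MN) (g : Gam) : A := u (eps g) * (r : mn_series iota Gam) g.

Let sn_twisted s : twisted iota s (u s).
Proof.
move=> l; transitivity (u s * ((u s)^-1 * iota l * u s)).
  by rewrite !mulrA mulrV ?mul1r ?sn_unit.
by congr (_ * _); apply/esym/sn_conj.
Qed.

Lemma malcev_neumann_hahn_ring :
  hahn_ring (fun g a => twisted iota (eps g) a) untwisted_coef.
Proof.
split.
- by move=> r s g; rewrite /untwisted_coef -mulrBr.
- move=> r s g; rewrite {1}/untwisted_coef mn_mulE mn_mul_coefE//.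
  by rewrite mulrA mulrV ?mul1r ?sn_unit.
- move=> g; rewrite /untwisted_coef /= /mn_monomial_coef; case: eqP => [->|_].
    by rewrite (eps0 epsD) sn_one mulr1.
  by rewrite mulr0.
- move=> r s rs; apply: mn_seriesP => g; apply: (mulrI (sn_unit u (eps g))).
  exact: rs.
- move=> r; apply: well_ordered_sub (mn_coef_wo r) => g; rewrite !inE /=.
  by apply: contra_neq => r0; rewrite /untwisted_coef r0 mulr0.
- move=> r g l; rewrite /untwisted_coef mulrA sn_twisted -!mulrA.
  by have /mem_cent -> := mn_coefC r g.
move=> h hH hwo; pose r g := (u (eps g))^-1 * h g.
have rP : r \in @mn_series_pred _ _ _ iota Gam.
  apply/asboolP; split=> [g|].
    apply/mem_cent => l; apply: (mulrI (sn_unit u (eps g))).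
    pose k := ((eps g)^-1)%g l.
    have -> : l = eps g k by rewrite /k -galM ?memvf// mulVg gal_id.
    rewrite /r !mulrA mulrV ?sn_unit// mul1r -hH -sn_twisted.
    by rewrite mulrK ?sn_unit.
  apply: well_ordered_sub hwo => g; rewrite !inE /=.
  by apply: contra_neq => h0; rewrite /r h0 mulr0.
exists (MNSeries rP : MN) => g; rewrite /untwisted_coef /= /r.
by rewrite mulrA mulrV ?mul1r ?sn_unit.
Qed.

Hypotheses (divA : division_ring A) (ZA : ('Z({:A}) = 1)%VS)
  (galK : galois 1 {:K}) (eps_surj : forall s, exists g, eps g = s).

Lemma malcev_neumann_fin_dim : fin_dim_over_center MN.
Proof.
have [I [b [_ bS _]]] :=
  crossed_hahn_basis epsD malcev_neumann_hahn_ring divA ZA galK eps_surj.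
exists #|I|, (fun i => b (enum_val i)) => x; have [z zC ->] := bS x.
exists (fun i => z (enum_val i)); split=> [i y|]; first exact: zC.
rewrite (reindex enum_rank) /=; last by exists enum_val => ? _; rewrite (enum_valK, enum_rankK).
by apply: eq_bigr => i _; rewrite enum_rankK zC.
Qed.

End MalcevNeumannHahn.

(** * Commutative subalgebras as Galois extensions *)

Section CommutativeSubalgebra.
Variables (F : fieldType) (A : falgType F) (divA : division_ring A).

Lemma field_of_aspace (P : {aspace A}) : {in P &, commutative *%R} ->
  exists (L : fieldExtType F) (j : 'AHom(L, A)), (j @: {:L})%VS = P.
Proof.
move=> commP; have fieldA : GRing.field_axiom A.
  by move=> a; exact: division_unit.
have mulC : commutative (@GRing.mul (subvs_of P)).
  by move=> x y; apply: val_inj; apply: commP; exact: subvsP.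
have unitP : GRing.field_axiom (subvs_of P).
  by move=> x x0; apply: vsval_unitr; apply: fieldA.
pose cM := GRing.PzRing_hasCommutativeMul.Build (subvs_of P) mulC.
pose cuL : comUnitRingType := HB.pack (subvs_of P) cM.
pose fM := GRing.ComUnitRing_isField.Build cuL unitP.
pose L : fieldExtType F := HB.pack (subvs_of P) cM fM.
have jM : ahom_in {:L} (linfun (vsval : L -> A)).
  apply/ahomP_tmp; split=> [|x y]; rewrite !lfunE //=.
  exact: skew_field_algid1.
exists L, (AHom jM); apply/eqP; rewrite eqEsubv; apply/andP; split; apply/subvP => a.
  by case/memv_imgP => x _ ->; rewrite lfunE; exact: subvsP.
move=> aP; apply/memv_imgP; exists (Subvs aP : L); first exact: memvf.
by rewrite lfunE.
Qed.

Lemma ahom_factor (L L1 : fieldExtType F) (j : 'AHom(L, A)) (i : {rmorphism L1 -> A}) :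
  (forall x, i x \in limg j) -> exists phi : {rmorphism L1 -> L}, forall x, j (phi x) = i x.
Proof.
move=> ij; pose phi x := (j^-1)%VF (i x).
have phiK x : j (phi x) = i x by rewrite /phi limg_lfunVK.
have phiB : zmod_morphism phi.
  by move=> x y; apply: (fmorph_inj j); rewrite /= linearB /= !phiK rmorphB.
have phiM : monoid_morphism phi.
  split=> [|x y]; apply: (fmorph_inj j); rewrite /= phiK ?rmorph1//.
  by rewrite !rmorphM /= !phiK.
pose phiA := GRing.isZmodMorphism.Build L1 L phi phiB.
pose phiMM := GRing.isMonoidMorphism.Build L1 L phi phiM.
by exists (HB.pack phi phiA phiMM : {rmorphism L1 -> L}) => x; exact: phiK.
Qed.

End CommutativeSubalgebra.

Section SplitSeparable.
Variable F : fieldType.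

(** In Galois terms, a is separable with all its conjugates in L.  The polynomial
    is not required to be the minimal one, which makes the property stable under
    extension of L. *)
Definition split_separable (L : fieldExtType F) (a : L) :=
  exists s : seq L, [/\ uniq s, a \in s & \prod_(b <- s) ('X - b%:P) \is a polyOver 1%VS].

Lemma split_separable_morph (L1 L : fieldExtType F) (phi : {rmorphism L1 -> L}) (a : L1) :
  (forall k : F, phi k%:A = k%:A) -> split_separable a -> split_separable (phi a).
Proof.
move=> phi1 [s [us sa s1]]; exists (map phi s); split.
- by rewrite map_inj_uniq//; exact: fmorph_inj.
- exact: map_f.
rewrite big_map -(eq_bigr _ (fun b _ => map_polyXsubC phi b)) -rmorph_prod.
apply/polyOverP => i; rewrite coef_map; have /polyOverP/(_ i)/vlineP[k ->] := s1.
by apply/vlineP; exists k; exact: phi1.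
Qed.

(** Artin's argument: the product of the 'X - b over the distinct images b of a
    is fixed by all chi t. *)
Lemma split_separable_orbit (L : fieldExtType F) (T : finType)
    (chi : T -> {rmorphism L -> L}) :
    (forall t t', exists t'', forall x, chi t' (chi t x) = chi t'' x) ->
    (exists t, forall x, chi t x = x) ->
    (forall x, (forall t, chi t x = x) -> x \in 1%VS) ->
  forall a : L, split_separable a.
Proof.
move=> chiM [t1 chi1] chiF a; pose s := undup [seq chi t a | t <- enum T].
exists s; split; first exact: undup_uniq.
  by rewrite mem_undup; apply/mapP; exists t1; rewrite ?mem_enum.
have sP b : reflect (exists t, b = chi t a) (b \in s).
  by rewrite mem_undup; apply: (iffP mapP) => [[t _ ->]|[t ->]]; exists t; rewrite ?mem_enum.
have perm t : perm_eq (map (chi t) s) s.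
  have us : uniq (map (chi t) s) by rewrite map_inj_uniq ?undup_uniq//; exact: fmorph_inj.
  apply: uniq_perm => //; first exact: undup_uniq.
  have sub : {subset map (chi t) s <= s}.
    move=> _ /mapP[_ /sP[t' ->] ->]; apply/sP.
    by have [t'' E] := chiM t' t; exists t''.
  by have [_ ss] := uniq_min_size us sub (eq_leq (esym (size_map _ _))).
apply/polyOverP => i; apply: chiF => t; rewrite -coef_map.
suff -> : map_poly (chi t) (\prod_(b <- s) ('X - b%:P)) = \prod_(b <- s) ('X - b%:P) by [].
rewrite rmorph_prod (eq_bigr _ (fun b _ => map_polyXsubC (chi t) b)).
by rewrite -(big_map (chi t) xpredT (fun b => 'X - b%:P)) (perm_big _ (perm t)).
Qed.

Lemma split_separable_galois (K : splittingFieldType F) (a : K) :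
  galois 1 {:K} -> split_separable a.
Proof.
move=> /(galois_factors (sub1v _))/(_ a (memvf a))[r [_ us mE]].
exists [seq (s : gal_of {:K}) a | s <- r].
have pE : \prod_(b <- [seq (s : gal_of {:K}) a | s <- r]) ('X - b%:P) = minPoly 1 a.
  by rewrite mE.
split=> //; last by rewrite pE minPolyOver.
by rewrite -root_prod_XsubC pE root_minPoly.
Qed.

Lemma galois_of_split_separable (A : falgType F) (L : fieldExtType F) (j : 'AHom(L, A))
    (rs : seq L) :
    (forall a : L, a \in rs -> split_separable a) -> <<1 & rs>>%VS = {:L}%VS ->
  exists (L' : splittingFieldType F) (j' : 'AHom(L', A)),
    galois 1 {:L'} /\ (j' @: {:L'} = j @: {:L})%VS.
Proof.
move=> rsP genL.
have /choice[s sP] : forall a : L, exists s : seq L, a \in rs ->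
    [/\ uniq s, a \in s & \prod_(b <- s) ('X - b%:P) \is a polyOver 1%VS].
  move=> a; have [/rsP[s sP]|_] := boolP (a \in rs); last by exists [::].
  by exists s.
have sepL : separable 1 {:L}.
  rewrite -genL; apply: separable_Fadjoin_seq; apply/allP => a /sP[us sa s1].
  apply/separable_elementP; exists (\prod_(b <- s a) ('X - b%:P)); split=> //.
    by rewrite root_prod_XsubC.
  by rewrite separable_prod_XsubC.
have splitL : SplittingField.axiom L.
  pose roots := flatten [seq s a | a <- rs].
  exists (\prod_(b <- roots) ('X - b%:P)).
    rewrite big_flatten big_map big_seq; apply: rpred_prod => a ars.
    by have [] := sP a ars.
  exists roots; first exact: eqpxx.
  apply/eqP; rewrite eqEsubv subvf -genL.
  apply/Fadjoin_seqP; split; first exact: subv_adjoin_seq.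
  move=> a ars; apply: seqv_sub_adjoin; apply/flattenP; exists (s a); first exact: map_f.
  by have [] := sP a ars.
pose splitM := FieldExt_isSplittingField.Build F L splitL.
pose L' : splittingFieldType F := HB.pack L splitM.
exists L', (j : 'AHom(L', A)); split=> //.
by apply/and3P; split; [exact: sub1v|exact: sepL|exact: normalFieldf].
Qed.

End SplitSeparable.

(** * The maximal subfield generated by K and the residue field *)

Section MaximalSubfield.
Variables (F : fieldType) (A : falgType F) (K : splittingFieldType F).
Variables (iota : 'AHom(K, A)) (d : nat).
Hypotheses (divA : division_ring A) (ZA : ('Z({:A}) = 1)%VS)
  (dimA : \dim {:A} = (d ^ 2)%N) (galK : galois 1 {:K}).
Variables (U : {vspace A}) (S : {set gal_of {:K}}) (tame : tame_residue iota d U S).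

Let V := (iota @: {:K})%VS.
Let P := (V * U)%VS.

Let memV k : iota k \in V. Proof. by rewrite memv_img ?memvf. Qed.

Let one_V : 1 \in V. Proof. by rewrite -(rmorph1 iota) memV. Qed.

Let V_centU : (V <= 'C(U))%VS.
Proof.
apply/centvsP => _ a /memv_imgP[k _ ->] aU.
exact: (res_iota tame aU).
Qed.

Let V_centV : (V <= 'C(V))%VS.
Proof.
by apply/centvsP => _ _ /memv_imgP[k _ ->] /memv_imgP[l _ ->]; rewrite -!rmorphM mulrC.
Qed.

Let U_centU : (U <= 'C(U))%VS.
Proof. by apply/centvsP; exact: (resC tame). Qed.

Let P_centP : (P <= 'C(P))%VS.
Proof.
have cV : (P <= 'C(V))%VS by apply: (@prodv_sub _ _ _ _ 'C(V)%AS) => //=; rewrite centvC.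
have cU : (P <= 'C(U))%VS by apply: (@prodv_sub _ _ _ _ 'C(U)%AS).
by apply: (@prodv_sub _ _ _ _ 'C(P)%AS); rewrite /= centvC.
Qed.

Let UU : (U * U <= U)%VS. Proof. by apply/prodvP; exact: (resM tame). Qed.

Let U_aspace : {aspace A}.
Proof. by exists U; rewrite /is_aspace UU andbT has_algid1// (res1 tame). Defined.

Let PP : (P * P <= P)%VS.
Proof.
have UV : (U * V <= V * U)%VS.
  apply/prodvP => a b aU bV; rewrite (_ : a * b = b * a) ?memv_mul//.
  by have /centvsP VU := V_centU; rewrite (VU b a).
have VV : (V * V <= V)%VS by rewrite /V -aimgM limgS ?subvf.
have -> : (P * P = V * (U * V) * U)%VS by rewrite /P !prodvA.
apply: subv_trans (prodvSl _ (prodvSr _ UV)) _.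
have -> : (V * (V * U) * U = (V * V) * (U * U))%VS by rewrite !prodvA.
exact: prodvS.
Qed.

Let P_aspace : {aspace A}.
Proof.
exists P; rewrite /is_aspace PP andbT has_algid1//.
by rewrite -[1]mul1r memv_mul ?(res1 tame).
Defined.

(** V U is Galois over F since it is generated by the Galois extensions V and U,
    and it is maximal because its dimension is at least d, which bounds that of
    its centralizer by d. *)
Lemma tame_residue_maximal_subfield :
  exists (L : splittingFieldType F) (j : 'AHom(L, A)),
    [/\ galois 1 {:L}, (V <= j @: {:L})%VS & maximal_subfield (j @: {:L})%VS].
Proof.
have [|L [j jP]] := field_of_aspace divA (P := P_aspace); first exact/centvsP.
have [|LU [jU jUU]] := field_of_aspace divA (P := U_aspace); first exact: (resC tame).
rewrite /= in jP jUU.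
have VP : (V <= P)%VS.
  by apply/subvP => a aV; rewrite -[a]mulr1 memv_mul ?(res1 tame).
have UP : (U <= P)%VS by apply/subvP => a aU; rewrite -[a]mul1r memv_mul.
have [k|phi phiE] := @ahom_factor _ _ L K j iota; first by rewrite jP; exact/(subvP VP)/memV.
have jUmem x : jU x \in U by rewrite -jUU memv_img ?memvf.
have [x|psi psiE] := @ahom_factor _ _ L LU j jU; first by rewrite jP; exact: (subvP UP _ (jUmem x)).
have jalg (M : fieldExtType F) (i : 'AHom(M, A)) (k : F) : i k%:A = k%:A.
  by rewrite linearZ rmorph1.
have phi1 (k : F) : phi k%:A = k%:A by apply: (fmorph_inj j); rewrite /= phiE /= !jalg.
have psi1 (k : F) : psi k%:A = k%:A by apply: (fmorph_inj j); rewrite /= psiE /= !jalg.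
(* The e t act on U as a group whose fixed field is F. *)
have sepU (x : LU) : split_separable x.
  have [T [e [eU eUU eM e1 eF]]] := res_galois tame.
  have /choice[chi chiE] : forall t, exists chi : {rmorphism LU -> LU},
      forall y, jU (chi y) = (e t)^-1 * jU y * e t.
    move=> t; pose i y := (e t)^-1 * jU y * e t.
    have iB : zmod_morphism i by move=> y z; rewrite /i rmorphB mulrBr mulrBl.
    have iM : monoid_morphism i.
      split=> [|y z]; first by rewrite /i rmorph1 mulr1 mulVr.
      by rewrite /i rmorphM !mulrA mulrK.
    pose iA := GRing.isZmodMorphism.Build LU A i iB.
    pose iMM := GRing.isMonoidMorphism.Build LU A i iM.
    have [y|chi chiE] := @ahom_factor _ _ LU LU jU (HB.pack i iA iMM); last by exists chi.
    by rewrite jUU; exact: eUU.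
  apply: (@split_separable_orbit _ _ _ chi) => [t t'||y yF].
  - have [t'' tE] := eM t t'; exists t'' => y; apply: (fmorph_inj jU).
    by rewrite /= !chiE tE.
  - have [t tE] := e1; exists t => y; apply: (fmorph_inj jU).
    by rewrite /= chiE tE.
  have /vlineP[k kE] : jU y \in 1%VS by apply: eF => // t; rewrite -chiE yF.
  by apply/vlineP; exists k; apply: (fmorph_inj jU); rewrite /= kE jalg.
pose rs := [seq phi b | b <- vbasis {:K}] ++ [seq psi b | b <- vbasis {:LU}].
have rsP (a : L) : a \in rs -> split_separable a.
  rewrite mem_cat => /orP[] /mapP[b _ ->].
    exact: split_separable_morph phi1 (split_separable_galois _ galK).
  exact: split_separable_morph psi1 (sepU _).
have gen (M : fieldExtType F) (chi : {rmorphism M -> L}) x :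
    (forall k : F, chi k%:A = k%:A) -> {subset map chi (vbasis {:M}) <= rs} ->
    chi x \in <<1 & rs>>%VS.
  move=> chi1 sub; rewrite (coord_vbasis (memvf x)) rmorph_sum; apply: memv_suml => i _.
  rewrite /= -mulr_algl rmorphM chi1 mulr_algl memvZ// seqv_sub_adjoin// sub//.
  by apply: map_f; rewrite mem_nth ?size_tuple.
have genL : <<1 & rs>>%VS = {:L}%VS.
  apply/eqP; rewrite eqEsubv subvf; apply/subvP => x _.
  have : j x \in (j @: <<1 & rs>>)%VS.
    apply: (subvP (_ : P <= _)%VS); last by rewrite -jP memv_img ?memvf.
    apply/prodvP => _ b /memv_imgP[k _ ->]; rewrite -jUU => /memv_imgP[y _ ->].
    rewrite -phiE -psiE -rmorphM memv_img// memvM// gen//.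
      by move=> a; rewrite mem_cat => ->.
    by move=> a; rewrite mem_cat orbC => ->.
  by case/memv_imgP => y yW /(fmorph_inj j) ->.
(* The products of the powers of th below |S| with a basis of U are independent. *)
have dimP : (d <= \dim P)%N.
  apply: leq_trans (res_dim tame) _; have [th thgen] := galois_generator galK.
  pose b (p : 'I_#|S| * 'I_(\dim U)) : A := iota th ^+ p.1 * vfam U p.2.
  have bP p : b p \in P by rewrite memv_mul ?vfam_mem// -rmorphXn memV.
  suff bI : fam_indep (in_alg A) b.
    by have := fam_indep_le_spans (Y := fun a => a \in P) bP bI (@vfam_spans _ _ P); rewrite card_prod !card_ord.
  move=> e e0; pose m (i : 'I_#|S|) := \sum_j (e (i, j))%:A * vfam U j.
  have mU i : m i \in U.
    by apply: memv_suml => q _; rewrite mulr_algl memvZ ?vfam_mem.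
  have m0 : \sum_(i < #|S|) iota th ^+ i * m i = 0.
    transitivity (\sum_(i < #|S|) \sum_q (e (i, q))%:A * b (i, q)).
      apply: eq_bigr => i _; rewrite mulr_sumr; apply: eq_bigr => q _.
      by rewrite !mulr_algl scalerAr.
    by rewrite pair_big -[RHS]e0; apply: eq_bigr => -[].
  have /choice[mu muE] : forall i, exists x, j x = m i.
    move=> i; have : m i \in (j @: {:L})%VS by rewrite jP; exact: (subvP UP _ (mU i)).
    by case/memv_imgP => x _ ->; exists x.
  pose q : {poly L} := \poly_(i < #|S|) if insub i is Some i' then mu i' else 0.
  have qi (i : 'I_#|S|) : q`_i = mu i by rewrite coef_poly ltn_ord valK.
  (* Conjugating a relation between the powers of th over U by a leading
     coefficient of M of class s fixes U and maps th to s th. *)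
  have qroot s : s \in S -> q.[phi (s th)] = 0.
    move=> sS; have [a [aU ta aC]] := res_ramified tame sS.
    apply: (fmorph_inj j); rewrite rmorph0 (horner_coef_wide _ (size_poly _ _)).
    rewrite rmorph_sum; apply: (mulrI aU); rewrite mulr0 mulr_sumr.
    transitivity ((\sum_(i < #|S|) iota th ^+ i * m i) * a); last by rewrite m0 mul0r.
    rewrite mulr_suml; apply: eq_bigr => i _.
    have tha : iota th ^+ i * a = a * iota (s th) ^+ i.
      by have := ta (th ^+ i); rewrite /= !rmorphXn.
    rewrite -[RHS]mulrA -(aC _ (mU i)) [RHS]mulrA tha -[RHS]mulrA; congr (a * _).
    rewrite qi rmorphM rmorphXn /= phiE muE -!rmorphXn.
    exact/esym/(res_iota tame (mU i)).
  have q0 : q = 0.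
    apply/eqP/negPn/negP => qn0.
    have := max_poly_roots qn0 (rs := [seq phi ((s : gal_of {:K}) th) | s <- enum S]).
    rewrite size_map -cardE => mx.
    suff : (#|S| < size q)%N by rewrite ltnNge size_poly.
    apply: mx; first by apply/allP => _ /mapP[s /[!mem_enum] sS ->]; apply/rootP/qroot.
    rewrite map_inj_uniq ?enum_uniq// => s t /(fmorph_inj phi).
    by move/(gal_generator_inj thgen).
  move=> [i k]; apply: (@vfam_indep _ _ U (fun k => e (i, k))).
  by rewrite -/(m i) -muE -qi q0 coef0 rmorph0.
have [L' [j' [galL' j'P]]] := galois_of_split_separable j rsP genL.
exists L', j'; rewrite j'P jP; split=> //; split.
  split.
  - by rewrite -[1]mul1r memv_mul ?(res1 tame).
  - by move=> a b aP bP; apply: (subvP PP); rewrite memv_mul.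
  - exact/centvsP.
  move=> a aP a0; exists a^-1; last by rewrite mulrV// division_unit.
  by rewrite -[P]/(asval P_aspace) memvV.
move=> N [_ _ NC _] PN; have NP : (N <= 'C(P))%VS.
  by rewrite centvC; apply/centvsP => a b aP bN; apply: NC => //; exact: (subvP PN).
have := galois_centralizer_dim j' divA ZA galL'; rewrite j'P jP dimA => dimC.
have dimL' : \dim {:L'} = \dim P.
  have /lker0P/eqP k0 : injective j' := fmorph_inj j'.
  by rewrite -jP -j'P limg_dim_eq// k0 capv0.
have d_gt0 : (0 < d)%N.
  by rewrite lt0n; apply: contraTneq (adim_gt0 {:A}%AS) => d0; rewrite dimA d0.
have dimCd : (\dim 'C(P) <= d)%N.
  by rewrite -(leq_pmul2l d_gt0) mulnn -dimC dimL' leq_mul2r dimP orbT.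
apply/esym/eqP; rewrite -(dimv_leqif_eq PN) eqn_leq dimvS//=.
exact: leq_trans (dimvS NP) (leq_trans dimCd dimP).
Qed.

End MaximalSubfield.

Theorem corollary1p6
    (F : fieldType) (A : falgType F) (d : nat)
    (K : splittingFieldType F) (iota : 'AHom(K, A))
    (Gam : orderedZmodType) (eps : Gam -> gal_of {:K})
    (epsD : {morph eps : g h / g + h >-> (g * h)%g})
    (u : skolem_noether_choice iota) :
  division_ring A ->
  ('Z({:A}) = 1)%VS ->
  \dim {:A} = (d ^ 2)%N ->
  (forall p, p \in [pchar F] -> ~~ (p %| d)%N) ->
  galois 1 {:K} ->
  abelian 'Gal({:K} / 1) ->
  (forall s : gal_of {:K}, exists g : Gam, eps g = s) ->
  ~ (exists (L : splittingFieldType F) (j : 'AHom(L, A)),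
       [/\ galois 1 {:L},
           (iota @: {:K} <= j @: {:L})%VS
         & maximal_subfield (j @: {:L})%VS]) ->
  noncrossed_product_division_algebra (malcev_neumann epsD u).
Proof.
move=> divA ZA dimA pchar_d galK _ eps_surj noL.
have hD := malcev_neumann_hahn_ring epsD u.
split.
- exact: crossed_hahn_division_ring hD divA.
- exact: malcev_neumann_fin_dim.
move=> [E [L [f [rangeE galL maxM]]]]; apply: noL.
have [U [S tame]] := crossed_tame_residue epsD hD divA ZA galK eps_surj dimA pchar_d
  galL rangeE maxM.
exact: (tame_residue_maximal_subfield divA ZA dimA galK tame).
Qed.
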